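(* Let $F:\mathbb{R}^n\to\mathbb{R}$ be a convex differentiable function with $X^*:=\operatorname{argmin} F\neq\emptyset$ and $F^*:=\inf F$. Let $\gamma>2$ and $\alpha>0$, let $t_0>0$, and let $x:[t_0,+\infty)\to\mathbb{R}^n$ be a solution of $$\ddot{x}(t)+\frac{\alpha}{t}\dot{x}(t)+\nabla F(x(t))=0 .$$ If $F$ is coercive and satisfies $\mathbf{H}_1(\gamma)$ and $\mathbf{H}_2(\gamma)$, and if $\alpha\geq\frac{\gamma+2}{\gamma-2}$, then, as $t\to+\infty$, $$F(x(t))-F^*=O\left(\frac{1}{t^{\frac{2\gamma}{\gamma-2}}}\right)\quad\text{and}\quad \|\dot x(t)\|=O\left(\frac{1}{t^{\frac{\gamma}{\gamma-2}}}\right).$$ Moreover the trajectory $x(t)$ has finite length and it converges, as $t\to+\infty$, to a minimizer $x^*$ of $F$.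
   Context: $\mathbb{R}^n$ carries the Euclidean scalar product $\langle\cdot,\cdot\rangle$ and norm $\|\cdot\|$; $B(x^*,r)$ is the open Euclidean ball of center $x^*$ and radius $r$; $d(x,X^* )$ is the distance from $x$ to $X^*$. Coercive means $F(x)\to+\infty$ as $\|x\|\to+\infty$. Finite length means $\int_{t_0}^{+\infty}\|\dot x(t)\|\,dt<+\infty$. For a convex differentiable $F:\mathbb{R}^n\to\mathbb{R}$ with $X^*=\operatorname{argmin}F\neq\emptyset$ and $F^*=\inf F$: Hypothesis $\mathbf{H}_1(\gamma)$ ($\gamma\geq 1$): for any minimizer $x^*\in X^*$ there exists $\eta>0$ such that $$\forall x\in B(x^*,\eta),\quad F(x)-F^*\leq\frac{1}{\gamma}\langle\nabla F(x),x-x^*\rangle .$$ Hypothesis $\mathbf{H}_2(r)$ ($r\geq 1$): for any minimizer $x^*\in X^*$ there exist $K>0$ and $\varepsilon>0$ such that $$\forall x\in B(x^*,\varepsilon),\quad K\,d(x,X^* )^r\leq F(x)-F^* .$$ Standing assumption: for any initial conditions $(x_0,v_0)\in\mathbb{R}^n\times\mathbb{R}^n$, the Cauchy problem for the differential equation with $x(t_0)=x_0$, $\dot x(t_0)=v_0$ has a unique global solution on $[t_0,+\infty)$. *)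

(* Defs.v *)
From HB Require Import structures.
From mathcomp Require Import all_boot all_order all_algebra.
From mathcomp Require Import all_classical all_reals all_analysis.

Set Implicit Arguments.
Unset Strict Implicit.
Unset Printing Implicit Defensive.

Import Order.TTheory GRing.Theory Num.Theory.
Import numFieldNormedType.Exports.

Local Open Scope classical_set_scope.
Local Open Scope ring_scope.

(* Lets the Landau notations be used at +oo. *)
Canonical pinfty_filter_on (R : realType) :=
  FilterType (pinfty_nbhs R) (@filter_filter _ _ proper_pinfty_nbhs).

Section Euclidean.
Context {R : realType} {n : nat}.
Implicit Types u v x : 'rV[R]_n.

Definition dot u v : R := \sum_(i < n) u 0 i * v 0 i.

(* The library norm `|u| on 'rV[R]_n is the sup norm; it induces the same
   topology, so limits and differentiability are those of the library. *)
Definition enorm u : R := Num.sqrt (dot u u).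

Definition eball x (r : R) : set 'rV[R]_n := [set y | enorm (y - x) < r].

Definition edistance x (A : set 'rV[R]_n) : R := inf [set enorm (x - y) | y in A].

End Euclidean.

Section Objective.
Context {R : realType} {n : nat}.
Variable F : 'rV[R]_n -> R.

Definition grad (x : 'rV[R]_n) : 'rV[R]_n := \row_(i < n) 'D_(delta_mx 0 i) F x.

Definition argmin : set 'rV[R]_n := [set x | forall y, F x <= F y].

Definition inf_val : R := inf (range F).

Definition coercive : Prop :=
  forall M : R, exists A : R, forall x, A <= enorm x -> M <= F x.

Definition H1 (gamma : R) : Prop :=
  forall xs, argmin xs -> exists2 eta : R, 0 < eta &
    forall x, eball xs eta x -> F x - inf_val <= gamma^-1 * dot (grad x) (x - xs).

Definition H2 (r : R) : Prop :=
  forall xs, argmin xs -> exists K eps : R, [/\ 0 < K, 0 < eps &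
    forall x, eball xs eps x -> K * edistance x argmin `^ r <= F x - inf_val].

End Objective.

Section Ode.
Context {R : realType} {n : nat}.

(* g is the derivative of f on [t0, +oo[, one-sided at t0; the values of f and
   g on ]-oo, t0[ are irrelevant. *)
Definition is_derive_from (t0 : R) (f g : R -> 'rV[R]_n) : Prop :=
  (forall t, t0 < t -> is_derive t 1 f (g t)) /\
  h^-1 *: (f (t0 + h) - f t0) @[h --> 0^'+] --> g t0.

(* v is the velocity of x and a its acceleration. *)
Definition is_solution (F : 'rV[R]_n -> R) (alpha t0 : R)
    (x v : R -> 'rV[R]_n) : Prop :=
  is_derive_from t0 x v /\
  exists2 a : R -> 'rV[R]_n, is_derive_from t0 v a &
    forall t, t0 <= t -> a t + (alpha / t) *: v t + grad F (x t) = 0.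

Definition well_posed (F : 'rV[R]_n -> R) (alpha t0 : R) : Prop :=
  forall x0 v0 : 'rV[R]_n,
    (exists x v, [/\ is_solution F alpha t0 x v, x t0 = x0 & v t0 = v0]) /\
    (forall x v y w,
      is_solution F alpha t0 x v -> x t0 = x0 -> v t0 = v0 ->
      is_solution F alpha t0 y w -> y t0 = x0 -> w t0 = v0 ->
      forall t, t0 <= t -> x t = y t).

End Ode.

(* Main.v *)
Require Import Defs.
From HB Require Import structures.
From mathcomp Require Import all_boot all_order all_algebra.
From mathcomp Require Import all_classical all_reals all_analysis.
From mathcomp Require Import measurable_realfun.
From mathcomp Require Import ring lra.

Set Implicit Arguments.
Unset Strict Implicit.
Unset Printing Implicit Defensive.

Import Order.TTheory GRing.Theory Num.Theory.
Import numFieldNormedType.Exports.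

Local Open Scope classical_set_scope.
Local Open Scope ring_scope.

(** Write lam = 2 / (gamma - 2), so that the claimed rates are
    t ^ (- (2 * lam + 2)) for the gap and t ^ (- (lam + 1)) for the speed, and
    the condition on alpha is alpha >= 2 * lam + 1. Let e(t) be the energy, that
    is the gap plus half of the squared speed, and for a minimizer c let
    w = x - c and k = |w|^2 / 2.

    Convergence. The function
    lyap = t^2 e + lam t <v, w> + lam (alpha - 1) k is nonnegative,
    controls both t^2 e and k, and the flatness condition at c makes it decrease
    at rate at least 2 lam t e as long as x stays in the ball where this
    condition holds (lyap_decay). So a trajectory that starts near c with t^2 e
    small converges to c. Nothing bounds from below the radius of these balls
    when c varies, and the limit has to be found without uniformity. The energy
    tends to 0 (energy_vanishes), hence the cluster points of the trajectory are
    minimizers. Take a cluster point c along times at which t^2 e is almost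
    equal to its infimum over the future. To leave the ball around c the
    trajectory would have to spend so much of lyap that t^2 e would drop below
    this infimum (no_exit). The trajectory is therefore trapped, t^2 e tends to
    0 along these times because lyap stays nonnegative, and lyap tends to 0
    (capture).

    Rates. Around the limit c, the function
    rlyap = t^2 e + lam t <v, w> - lam (alpha - 1 - 2 lam) k multiplied by
    t^(2 lam) is nonincreasing (weighted_rlyap_nonincreasing), whence
    t^2 e <= C1 k + C2 t^(- 2 lam) (energy_le_halfdist). It remains to prove that
    k = O(t^(- 2 lam)), although c need not be the minimizer closest to x(t): the
    danger is a slow drift towards c along the set of minimizers. Such a drift
    would need a force directed towards c, which convexity forbids.
    Quantitatively, for every minimizer y,
    <t v + (alpha - 1) w, y - c> <= t <v, w> + (alpha - 1) k + lyap / lam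
    (chord_inequality). If k is large compared with t^(- 2 lam), the growth
    condition shows that x(t) is close to the set of minimizers relatively to
    |w|; this set being convex, it contains a point y close to c + N w
    (chord_prolongation). Since the right-hand side is O(k), choosing N large
    gives t k' <= - 3 lam k (radial_decay): above the scale t^(- 2 lam), k
    decreases faster than t^(- 2 lam), hence it remains of this order
    (barrier, energy_rate). The speed is then integrable. *)

(** * Euclidean norm and convex sets *)

Section EuclideanNorm.
Context {R : realType} {n : nat}.
Implicit Types u v w : 'rV[R]_n.

Lemma dotC u v : dot u v = dot v u.
Proof. by apply: eq_bigr => i _; rewrite mulrC. Qed.

Lemma dotDl u v w : dot (u + v) w = dot u w + dot v w.
Proof. by rewrite -big_split; apply: eq_bigr => i _; rewrite mxE mulrDl. Qed.

Lemma dotZl (a : R) u v : dot (a *: u) v = a * dot u v.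
Proof. by rewrite mulr_sumr; apply: eq_bigr => i _; rewrite mxE mulrA. Qed.

Lemma dotNl u v : dot (- u) v = - dot u v.
Proof. by rewrite -scaleN1r dotZl mulN1r. Qed.

Lemma dotBl u v w : dot (u - v) w = dot u w - dot v w.
Proof. by rewrite dotDl dotNl. Qed.

Lemma dotDr u v w : dot u (v + w) = dot u v + dot u w.
Proof. by rewrite dotC dotDl 2!(dotC u). Qed.

Lemma dotZr (a : R) u v : dot u (a *: v) = a * dot u v.
Proof. by rewrite dotC dotZl dotC. Qed.

Lemma dotNr u v : dot u (- v) = - dot u v.
Proof. by rewrite dotC dotNl dotC. Qed.

Lemma dotBr u v w : dot u (v - w) = dot u v - dot u w.
Proof. by rewrite dotDr dotNr. Qed.

Lemma dotr0 u : dot u 0 = 0.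
Proof. by rewrite -(scale0r u) dotZr mul0r. Qed.

Lemma dot_sqr_comb (a b : R) u v : dot (a *: u + b *: v) (a *: u + b *: v)
  = a ^+ 2 * dot u u + 2 * a * b * dot u v + b ^+ 2 * dot v v.
Proof. by rewrite !(dotDl, dotDr, dotZl, dotZr) (dotC v u); ring. Qed.

Lemma dot_ge0 u : 0 <= dot u u.
Proof. by apply: sumr_ge0 => i _; rewrite -expr2 sqr_ge0. Qed.

Lemma enorm_ge0 u : 0 <= enorm u.
Proof. exact: sqrtr_ge0. Qed.

Lemma enorm2 u : enorm u ^+ 2 = dot u u.
Proof. by rewrite sqr_sqrtr // dot_ge0. Qed.

Lemma enormZ (a : R) u : enorm (a *: u) = `|a| * enorm u.
Proof.
by rewrite /enorm dotZl dotZr mulrA -expr2 sqrtrM ?sqr_ge0// sqrtr_sqr.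
Qed.

Lemma enormN u : enorm (- u) = enorm u.
Proof. by rewrite -scaleN1r enormZ normrN1 mul1r. Qed.

Lemma enorm_distC u v : enorm (u - v) = enorm (v - u).
Proof. by rewrite -enormN opprB. Qed.

Lemma normr_le_enorm u : `|u| <= enorm u.
Proof.
rewrite [leLHS]/Num.Def.normr/= mx_normrE; apply: bigmax_le => [|[i j] _ /=].
  exact: enorm_ge0.
rewrite -sqrtr_sqr ler_wsqrtr// ord1 /dot (bigD1 j)//= expr2 lerDl.
by apply: sumr_ge0 => k _; rewrite -expr2 sqr_ge0.
Qed.

Lemma enorm_le_normr u : enorm u <= n%:R * `|u|.
Proof.
rewrite -[leRHS]ger0_norm ?mulr_ge0// -sqrtr_sqr ler_wsqrtr// /dot.
have le_coord i : u 0 i * u 0 i <= `|u| ^+ 2.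
  rewrite -expr2 -real_normK ?num_real// ler_sqr ?nnegrE//.
  rewrite [leRHS]/Num.Def.normr/= mx_normrE.
  by apply: le_trans; last apply: (le_bigmax _ _ (ord0, i)).
apply: (le_trans (ler_sum _ (fun i _ => le_coord i))).
rewrite sumr_const card_ord -[leLHS]mulr_natl exprMn ler_wpM2r ?sqr_ge0//.
by rewrite -natrX ler_nat; case: (n) => // k; rewrite expnS leq_pmulr // expn1.
Qed.

Lemma enorm_eq0 u : enorm u = 0 -> u = 0.
Proof.
by move=> u0; apply/normr0_eq0/le_anti; rewrite normr_ge0 -u0 normr_le_enorm.
Qed.

Lemma enorm0 : enorm (0 : 'rV[R]_n) = 0.
Proof. by rewrite -(scale0r 0) enormZ normr0 mul0r. Qed.

Lemma dot_le_enorm u v : dot u v <= enorm u * enorm v.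
Proof.
have [u0|u0] := eqVneq (enorm u) 0.
  by rewrite u0 mul0r (enorm_eq0 u0) dotC dotr0.
have [v0|v0] := eqVneq (enorm v) 0.
  by rewrite v0 mulr0 (enorm_eq0 v0) dotr0.
have u_gt0 : 0 < enorm u by rewrite lt_def u0 enorm_ge0.
have v_gt0 : 0 < enorm v by rewrite lt_def v0 enorm_ge0.
have := dot_ge0 (enorm v *: u - enorm u *: v).
rewrite !(dotBl, dotBr, dotZl, dotZr) -!enorm2 (dotC v u) => h.
have uv := mulr_gt0 u_gt0 v_gt0.
rewrite -(ler_pM2l uv); nra.
Qed.

Lemma normr_dot u v : `|dot u v| <= enorm u * enorm v.
Proof.
by rewrite ler_norml dot_le_enorm andbT lerNl -dotNl -(enormN u) dot_le_enorm.
Qed.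

Lemma ler_enormD u v : enorm (u + v) <= enorm u + enorm v.
Proof.
have uv0 : 0 <= enorm u + enorm v by rewrite addr_ge0// enorm_ge0.
rewrite -[leRHS]ger0_norm// -sqrtr_sqr ler_wsqrtr//.
rewrite dotDl !dotDr (dotC v u) -!enorm2; have := dot_le_enorm u v; nra.
Qed.

Lemma ler_enormB u v w : enorm (u - w) <= enorm (u - v) + enorm (v - w).
Proof. by rewrite -(subrKA v) ler_enormD. Qed.

(** Compactness of the closed balls of the sup norm, transported by the
    equivalence of the two norms. *)
Lemma bounded_seq_cluster (u : nat -> 'rV[R]_n) (M : R) :
  (forall j, enorm (u j) <= M) ->
  exists c, forall (eps : R) J, 0 < eps ->
    exists2 j, (J <= j)%N & enorm (u j - c) < eps.
Proof.
move=> uM; pose A : set 'rV[R]_n := closed_ball 0 (M + 1).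
have M0 : 0 <= M by exact: le_trans (enorm_ge0 _) (uM 0%N).
have M1 : 0 < M + 1 by rewrite ltr_pwDr.
have Acomp : compact A.
  apply: bounded_closed_compact; last exact: closed_ball_closed.
  exists (M + 1); split; first exact: num_real.
  move=> y My z; rewrite /A closed_ballE// /closed_ball_/= sub0r normrN => zM.
  exact: le_trans zM (ltW My).
have uA j : A (u j).
  rewrite /A closed_ballE// /closed_ball_/= sub0r normrN.
  by apply: le_trans (normr_le_enorm _) (le_trans (uM j) _); rewrite lerDl.
have [|c [_ cu]] := Acomp (u @ \oo) _.
  by exists 0%N => // j _; exact: uA.
exists c => eps J eps0.
have n1 : 0 < n%:R + 1 :> R by rewrite ltr_wpDl.
have [||y [[j /= Jj <-]]] := cu [set u j | j in [set j | (J <= j)%N]]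
    (ball c (eps / (n%:R + 1))).
- by exists J => // j /= Jj; exists j.
- by apply: nbhsx_ballx; rewrite divr_gt0.
rewrite -ball_normE /= distrC => ujc; exists j => //.
apply: le_lt_trans (enorm_le_normr _) _.
rewrite -(divfK (lt0r_neq0 n1) eps) mulrC.
apply: (@le_lt_trans _ _ (`|u j - c| * (n%:R + 1))).
  by rewrite ler_wpM2l// lerDl.
by rewrite ltr_pM2r.
Qed.

End EuclideanNorm.

Section ConvexSet.
Context {R : realType} {n : nat}.

(** Near a point c, a convex set looks like a cone: a chord leaving c can be
    prolonged N times, up to an error that is small with respect to its length.
    Directions form a compact set, so a chord whose direction almost repeats
    that of an earlier and N times longer one can be prolonged along it. *)
Lemma chord_prolongation (X : set 'rV[R]_n) (c : 'rV[R]_n) (N eps : R) :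
  X c -> (forall p s, X p -> 0 <= s <= 1 -> X (c + s *: (p - c))) ->
  0 < N -> 0 < eps ->
  exists2 rho : R, 0 < rho & forall p, X p -> enorm (p - c) < rho ->
    exists2 y, X y & enorm (y - c - N *: (p - c)) <= eps * enorm (p - c).
Proof.
move=> Xc Xstar N0 eps0; apply: contrapT => /forall2NP nrho.
have {}nrho j : exists p, [/\ X p, enorm (p - c) < (j.+1%:R)^-1 &
    forall y, X y -> eps * enorm (p - c) < enorm (y - c - N *: (p - c))].
  have j0 : 0 < (j.+1%:R : R)^-1 by rewrite invr_gt0 ltr0n.
  case: (nrho (j.+1%:R)^-1) => [/(_ j0)//|].
  move=> /existsNP[p /not_implyP[Xp /not_implyP[pj np]]].
  by exists p; split=> // y Xy; rewrite ltNge; apply/negP => le; apply: np; exists y.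
have [p /all_and3[Xp pj np]] := choice nrho.
have p0 j : 0 < enorm (p j - c).
  rewrite lt_def enorm_ge0 andbT; apply/eqP => /enorm_eq0 pc.
  by have := np j _ Xc; rewrite pc subrr scaler0 subrr enorm0 mulr0 ltxx.
pose d j := (enorm (p j - c))^-1 *: (p j - c).
have d1 j : enorm (d j) <= 1.
  by rewrite enormZ gtr0_norm ?invr_gt0// mulVf// gt_eqF.
have [d0 dcl] := bounded_seq_cluster d1.
have e0 : 0 < eps / (2 * N) by rewrite divr_gt0// mulr_gt0.
have [i _ di] := dcl _ 0%N e0.
have [j Jj dj] := dcl _ (Num.truncn (N / enorm (p i - c))).+1 e0.
have Npj : N * enorm (p j - c) <= enorm (p i - c).
  have jN : N < j.+1%:R * enorm (p i - c).
    rewrite -ltr_pdivrMr// (lt_le_trans (truncnS_gt _))// ler_nat.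
    exact: leq_trans Jj (leqnSn _).
  have jp : j.+1%:R * enorm (p j - c) < 1.
    by rewrite mulrC -ltr_pdivlMr ?ltr0n// mul1r.
  have j0 : 0 < j.+1%:R :> R by rewrite ltr0n.
  have := p0 i; have := p0 j; move: jN jp j0.
  move: (enorm (p i - c)) (enorm (p j - c)) (j.+1%:R : R) => a b k.
  by move=> h1 h2 h3 h4 h5; rewrite -(ler_pM2l h3); nra.
(* the prolonged chord is cut out of the longer chord from c to p i, at
   distance N * enorm (p j - c) from c *)
have s01 : 0 <= N * enorm (p j - c) / enorm (p i - c) <= 1.
  by rewrite divr_ge0 ?enorm_ge0 ?mulr_ge0 ?(ltW N0) ?enorm_ge0//= ler_pdivrMr ?mul1r.
have := np j _ (Xstar _ _ (Xp i) s01); apply/negP; rewrite -leNgt.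
rewrite (addrC c) addrK.
have -> : (N * enorm (p j - c) / enorm (p i - c)) *: (p i - c) - N *: (p j - c)
    = (N * enorm (p j - c)) *: (d i - d j).
  rewrite [in RHS]scalerBr /d [in RHS]scalerA [X in _ = _ - X]scalerA.
  by rewrite mulfK// gt_eqF.
rewrite enormZ gtr0_norm ?mulr_gt0//.
have dij : enorm (d i - d j) <= eps / N.
  apply: le_trans (ler_enormB _ d0 _) _; rewrite (enorm_distC d0).
  have -> : eps / N = eps / (2 * N) + eps / (2 * N).
    by field; rewrite gt_eqF.
  by rewrite lerD// ltW.
rewrite mulrAC ler_wpM2r ?enorm_ge0//.
by rewrite mulrC -ler_pdivlMr.
Qed.

(** A neighbour p of z in X serves as the end of the chord; replacing p by z then
    costs N * enorm (z - p). *)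
Lemma prolongation_near (X : set 'rV[R]_n) (c : 'rV[R]_n) (N : R) :
  X c -> (forall p s, X p -> 0 <= s <= 1 -> X (c + s *: (p - c))) -> 0 < N ->
  exists e rho : R, [/\ 0 < e, 0 < rho & forall z, enorm (z - c) < rho ->
    edistance z X < e * enorm (z - c) ->
    exists2 y, X y & enorm (y - c - N *: (z - c)) <= enorm (z - c)].
Proof.
move=> Xc Xstar N0.
pose e := Num.min 1 (2 * N)^-1.
have e0 : 0 < e by rewrite lt_min ltr01 invr_gt0 mulr_gt0.
have e1 : e <= 1 by rewrite ge_min lexx.
have eN : N * e <= 1 / 2.
  apply: (@le_trans _ _ (N * (2 * N)^-1)).
    by rewrite ler_wpM2l ?(ltW N0)// ge_min lexx orbT.
  by rewrite le_eqVlt; apply/orP; left; apply/eqP; field; rewrite gt_eqF.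
clearbody e.
have q0 : 0 < 1 / 4 :> R by rewrite divr_gt0.
have [rho rho0 prolong] := chord_prolongation Xc Xstar N0 q0.
exists e, (rho / 2); split; rewrite ?divr_gt0// => z z_rho zX.
have [p Xp zp] : exists2 p, X p & enorm (z - p) < e * enorm (z - c).
  have hinf : has_inf [set enorm (z - p) | p in X].
    split; first by exists (enorm (z - c)), c.
    by exists 0 => _ [p _ <-]; exact: enorm_ge0.
  have d0 : 0 < e * enorm (z - c) - edistance z X by rewrite subr_gt0.
  have [_ [p Xp <-]] := inf_adherent d0 hinf.
  by rewrite -[inf _]/(edistance z X) => zp; exists p => //; lra.
have pc : enorm (p - c) <= 2 * enorm (z - c).
  apply: le_trans (ler_enormB p z c) _; rewrite (enorm_distC p).
  have : e * enorm (z - c) <= 1 * enorm (z - c) by rewrite ler_wpM2r ?enorm_ge0.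
  lra.
have [|y Xy yp] := prolong p Xp; first by lra.
exists y => //.
have -> : y - c - N *: (z - c) = (y - c - N *: (p - c)) + (- N) *: (z - p).
  rewrite -[z - c](subrKA p) [z - p + _]addrC [N *: (_ + _)]scalerDr.
  by rewrite opprD addrA scaleNr.
apply: le_trans (ler_enormD _ _) _; rewrite enormZ normrN gtr0_norm//.
have h1 : N * enorm (z - p) <= N * (e * enorm (z - c)).
  by rewrite ler_wpM2l ?(ltW N0) ?(ltW zp).
have h2 : N * e * enorm (z - c) <= 1 / 2 * enorm (z - c).
  by rewrite ler_wpM2r ?enorm_ge0.
lra.
Qed.

End ConvexSet.

(** * Functions of time *)

Section Calculus.
Context {R : realType}.

Lemma le_of_sqr (a b : R) : 0 <= b -> a ^+ 2 <= b ^+ 2 -> a <= b.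
Proof. nra. Qed.

Lemma is_derive_dot (n : nat) (f g : R -> 'rV[R]_n) (df dg : 'rV[R]_n) (t : R) :
  is_derive t 1 f df -> is_derive t 1 g dg ->
  is_derive t 1 (fun s => dot (f s) (g s)) (dot df (g t) + dot (f t) dg).
Proof.
move=> [fD fE] [gD gE].
have coord (h : R -> 'rV[R]_n) dh i : derivable h t 1 -> 'D_1 h t = dh ->
    is_derive t 1 (fun s => h s 0 i) (dh 0 i).
  move=> hD <-; rewrite derive_mx// mxE; apply: derivableP.
  by move/derivable_mxP : hD; exact.
have -> : (fun s => dot (f s) (g s)) =
    \sum_(i < n) ((fun s => f s 0 i) * (fun s => g s 0 i)).
  by apply/funext => s; rewrite fct_sumE.
have D := is_derive_sum (fun i => is_deriveM (coord f df i fD fE) (coord g dg i gD gE)).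
apply: (is_derive_eq D); rewrite /= /dot -big_split/=; apply: eq_bigr => i _.
by rewrite addrC; congr (_ + _); exact: mulrC.
Qed.

Lemma diff_grad (n : nat) (F : 'rV[R]_n -> R) (y u : 'rV[R]_n) :
  differentiable F y -> 'd F y u = dot (grad F y) u.
Proof.
move=> Fy; rewrite {1}(row_sum_delta u) linear_sum; apply: eq_bigr => i _.
by rewrite linearZ /= mxE deriveE// mulrC.
Qed.

Lemma is_derive_along (n : nat) (F : 'rV[R]_n -> R) (f : R -> 'rV[R]_n)
    (df : 'rV[R]_n) (t : R) :
  differentiable F (f t) -> is_derive t 1 f df ->
  is_derive t 1 (fun s => F (f s)) (dot (grad F (f t)) df).
Proof.
move=> Ff [fD fE].
have fd : differentiable f t by exact/derivable1_diffP.
have Ffd : differentiable (F \o f) t by exact: differentiable_comp.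
apply: (@DeriveDef _ _ _ _ _ (F \o f)); first exact/derivable1_diffP.
by rewrite deriveE// diff_comp//= -diff_grad// -fE (deriveE _ fd).
Qed.

Lemma is_derive_continuous (f : R -> R) (d t : R) :
  is_derive t 1 f d -> {for t, continuous f}.
Proof. by move=> [/derivable1_diffP/differentiable_continuous]. Qed.

Lemma MVT_halfline (f df : R -> R) (a s t : R) :
  (forall u, a < u -> is_derive u 1 f (df u)) -> a < s -> s < t ->
  exists2 u, s < u < t & f t - f s = df u * (t - s).
Proof.
move=> fD as_ st; have [u] : exists2 u, u \in `]s, t[ & f t - f s = df u * (t - s).
  apply: MVT => // [u|]; first by rewrite in_itv/= => /andP[su _]; apply: fD; lra.
  apply: continuous_in_subspaceT => u /[!inE] /= /itvP us.
  by apply: is_derive_continuous (fD _ _); rewrite (lt_le_trans as_)// us.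
by rewrite in_itv/=; exists u.
Qed.

Lemma nonincreasing_on (f df : R -> R) (a s t : R) :
  (forall u, a < u -> is_derive u 1 f (df u)) ->
  a < s -> s <= t -> (forall u, s < u < t -> df u <= 0) -> f t <= f s.
Proof.
move=> fD as_; rewrite le_eqVlt => /predU1P[->//|st] df0.
have [u sut E] := MVT_halfline fD as_ st.
have := df0 u sut; nra.
Qed.

(** Add kappa times the logarithm, which diverges. *)
Lemma unbounded_below_halfline (f df : R -> R) (a kappa : R) :
  0 <= a -> 0 < kappa ->
  (forall u, a < u -> is_derive u 1 f (df u)) ->
  (forall u, a < u -> df u <= - (kappa / u)) ->
  forall M, exists2 t, a < t & f t < M.
Proof.
move=> a0 k0 fD dfk M.
have fln s t : a < s -> s <= t -> f t + kappa * ln t <= f s + kappa * ln s.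
  move=> as_ st; apply: (@nonincreasing_on (fun u => f u + kappa * ln u)
    (fun u => df u + kappa * u^-1) a) => // u; last first.
    by move=> /andP[su _]; rewrite -lerBrDr sub0r; apply/dfk/(lt_trans as_).
  move=> au; have u0 : 0 < u by exact: le_lt_trans au.
  have := is_derive1_ln u0 => lnD; have fu := fD _ au.
  exact: is_deriveD.
have a1 : a < a + 1 by lra.
have a10 : 0 < a + 1 by lra.
set r := Num.max 0 ((f (a + 1) - M + 1) / kappa).
have er : 1 <= expR r by rewrite -expR0 ler_expR le_max lexx.
exists ((a + 1) * expR r); first by rewrite (lt_le_trans a1)// ler_peMr// ltW.
have := fln (a + 1) ((a + 1) * expR r) a1; rewrite ler_peMr//= ?(ltW a10)// => /(_ isT).
rewrite lnM ?posrE ?expR_gt0// expRK mulrDr.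
suff : f (a + 1) - M + 1 <= kappa * r by lra.
by rewrite mulrC -ler_pdivrMr// le_max lexx orbT.
Qed.

(** The first passage time is the infimum of the times at which f is at least
    L. *)
Lemma first_passage (f : R -> R) (a b L : R) :
  a <= b -> {in `[a, b], continuous f} -> f a < L -> L <= f b ->
  exists t, [/\ a < t, t <= b, f t = L & forall s, a <= s -> s < t -> f s < L].
Proof.
move=> ab cf faL Lfb.
pose A := [set s | a <= s <= b /\ L <= f s].
have Ab : A b by split; rewrite ?ab ?lexx.
have hA : has_inf A by split; [exists b | exists a => s [/andP[]]].
have tb : inf A <= b by apply: ge_inf => //; case: hA.
have at_ : a <= inf A by apply: lb_le_inf; [exists b | move=> s [/andP[]]].
have tin : inf A \in `[a, b] by rewrite in_itv/= at_ tb.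
have below s : a <= s -> s < inf A -> f s < L.
  move=> as_ sA; rewrite ltNge; apply/negP => Lfs.
  have : A s by split; rewrite // as_/= (le_trans (ltW sA)).
  by move=> As; have := ge_inf hA.2 As; rewrite leNgt sA.
have geL : L <= f (inf A).
  rewrite leNgt; apply/negP => fL.
  have d0 : 0 < L - f (inf A) by lra.
  have [e /= e0 He] := (cvgrPdist_lt _ _).1 (cf _ tin) _ d0.
  have [s As sA] := inf_adherent e0 hA.
  have As_ : inf A <= s by apply: ge_inf => //; case: hA.
  have : `|inf A - s| < e by rewrite distrC ger0_norm; lra.
  by move=> /He /=; rewrite ltr_norml; case: As; lra.
have at1 : a < inf A.
  by rewrite lt_neqAle at_ andbT; apply: contraTneq geL => <-; rewrite -ltNge.
exists (inf A); split=> //; apply/le_anti; rewrite geL andbT leNgt; apply/negP => fL.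
have d0 : 0 < f (inf A) - L by lra.
have [e /= e0 He] := (cvgrPdist_lt _ _).1 (cf _ tin) _ d0.
pose s := Num.max a (inf A - e / 2).
have sA : s < inf A by rewrite gt_max at1/=; lra.
have : `|inf A - s| < e.
  rewrite ger0_norm; last by lra.
  have : inf A - e / 2 <= s by rewrite le_max lexx orbT.
  lra.
move=> /He /=; rewrite ltr_norml => /andP[_ h].
have := below s; rewrite le_max lexx sA => /(_ isT isT); lra.
Qed.

Lemma is_deriveDf (f g : R -> R) (df dg t : R) :
  is_derive t 1 f df -> is_derive t 1 g dg ->
  is_derive t 1 (fun s => f s + g s) (df + dg).
Proof. exact: is_deriveD. Qed.

Lemma is_deriveMf (f g : R -> R) (df dg t : R) :
  is_derive t 1 f df -> is_derive t 1 g dg ->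
  is_derive t 1 (fun s => f s * g s) (df * g t + f t * dg).
Proof.
move=> fD gD; apply: (is_derive_eq (is_deriveM fD gD)).
by rewrite addrC; congr (_ + _); exact: mulrC.
Qed.

Lemma is_deriveZf (f : R -> R) (c df t : R) :
  is_derive t 1 f df -> is_derive t 1 (fun s => c * f s) (c * df).
Proof. exact: is_deriveZ. Qed.

Lemma is_derive_sqr (t : R) : is_derive t 1 (fun s : R => s ^+ 2) (2 * t).
Proof.
have D := is_deriveMf (is_derive_id t (1 : R)) (is_derive_id t 1).
by apply: (is_derive_eq D); rewrite mul1r mulr1; lra.
Qed.

Lemma is_derive_powR (a t : R) : 0 < t ->
  is_derive t 1 (fun s : R => s `^ a) (a / t * t `^ a).
Proof.
move=> t_gt0; apply: (is_derive_eq (is_derive1_powR a t_gt0)).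
rewrite -mulrA; congr (_ * _).
rewrite powRB; last by rewrite (@gt_eqF _ _ t)//; apply: implybT.
by rewrite powRr1 ?ltW// mulrC.
Qed.

Lemma le_powR (a b r : R) : 0 <= r -> 0 <= a -> a <= b -> a `^ r <= b `^ r.
Proof.
by move=> r0 a0 ab; rewrite ge0_ler_powR// nnegrE//; exact: le_trans ab.
Qed.

(** In the application b is the distance to the limit, d the distance to the set
    of minimizers and g the gap. When d is at least a fixed fraction of b, a gap
    that grows like d ^ gam and is O((b / t) ^ 2) leaves room only for
    b = O(t ^ (- lam)), as b ^ (gam - 2) is O(t ^ (- 2)). *)
Lemma rescaled_growth (K e b d g t C gam lam : R) :
  0 < K -> 0 < e -> 0 < b -> 0 < t -> 2 < gam -> (gam - 2) * lam = 2 ->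
  K * d `^ gam <= g -> t ^+ 2 * g <= C * b ^+ 2 -> e * b <= d ->
  b ^+ 2 * t `^ (2 * lam) <= (C / (K * e `^ gam)) `^ lam.
Proof.
move=> K0 e0 b0 t0 gam2 gl Kd tg ebd.
have l0 : 0 < lam by rewrite -(@pmulr_rgt0 _ (gam - 2)) ?gl// subr_gt0.
have eg : 0 < e `^ gam by exact: powR_gt0.
have h1 : K * (e `^ gam * b `^ gam) <= g.
  apply: le_trans Kd; rewrite ler_pM2l// -powRM ?(ltW e0) ?(ltW b0)//.
  apply: le_powR => //; first by lra.
  by rewrite mulr_ge0 ?(ltW e0) ?(ltW b0).
have bg : b `^ gam = b `^ (gam - 2) * b ^+ 2.
  rewrite -powR_mulrn ?(ltW b0)// -powRD; first by congr (_ `^ _); lra.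
  by rewrite (@gt_eqF _ _ b)// implybT.
have b2 : 0 < b ^+ 2 by rewrite exprn_gt0.
have h2 : b `^ (gam - 2) * t ^+ 2 <= C / (K * e `^ gam).
  rewrite ler_pdivlMr ?mulr_gt0// -(ler_pM2r b2).
  apply: le_trans tg; rewrite bg in h1.
  apply: le_trans (ler_wpM2l (sqr_ge0 t) h1).
  by rewrite le_eqVlt; apply/orP; left; apply/eqP; ring.
have : (b `^ (gam - 2) * t ^+ 2) `^ lam <= (C / (K * e `^ gam)) `^ lam.
  by apply: le_powR => //; [exact: ltW | rewrite mulr_ge0 ?powR_ge0 ?sqr_ge0].
rewrite powRM ?powR_ge0 ?sqr_ge0// -powRrM gl powR_mulrn ?(ltW b0)//.
by rewrite -[t ^+ 2]powR_mulrn ?(ltW t0)// -powRrM.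
Qed.

Lemma derive_ge0_of_left_max (f : R -> R) (d a t : R) :
  is_derive t 1 f d -> a < t -> (forall s, a <= s -> s < t -> f s <= f t) ->
  0 <= d.
Proof.
move=> [fD fE] at_ fmax; rewrite leNgt; apply/negP => d0.
have : h^-1 *: ((f \o shift t) (h *: 1) - f t) @[h --> 0^'] --> d.
  by rewrite -fE; exact: fD.
move=> /cvgrPdist_lt/(_ (- d)) []; first by lra.
move=> e /= e0 He.
pose h := Num.min (e / 2) (t - a).
have h0 : 0 < h by rewrite lt_min; apply/andP; split; lra.
have he : h <= e / 2 by rewrite ge_min lexx.
have ha : h <= t - a by rewrite ge_min lexx orbT.
have := He (- h); rewrite /ball_/= sub0r opprK gtr0_norm// => /(_ _ _)/wrap[].
  lra.
rewrite oppr_eq0 gt_eqF// => /(_ isT).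
rewrite [_ *: 1]mulr1 ltr_norml => /andP[+ _].
have : f (- h + t) <= f t by apply: fmax; lra.
rewrite [_ *: _]/GRing.scale/= invrN mulNr => h1.
have h2 : 0 <= h^-1 by rewrite invr_ge0 ltW.
nra.
Qed.

(** At the first passage time at a level above A the derivative would be both
    nonnegative and negative. *)
Lemma barrier (f df : R -> R) (a s A : R) :
  (forall u, a < u -> is_derive u 1 f (df u)) -> a < s ->
  (forall u, s <= u -> A <= f u -> df u < 0) ->
  forall t, s <= t -> f t <= Num.max A (f s).
Proof.
move=> fD as_ dfneg t st; rewrite leNgt; apply/negP; rewrite gt_max => /andP[At ft].
have [L [AL sL Lt]] : exists L, [/\ A <= L, f s < L & L <= f t].
  by exists (Num.max A ((f s + f t) / 2)); rewrite le_max lt_max ge_max lexx; split; lra.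
have fc : {in `[s, t], continuous f}.
  move=> u; rewrite in_itv/= => /andP[su _].
  exact: is_derive_continuous (fD _ (lt_le_trans as_ su)).
have [t1 [st1 _ t1E before]] := first_passage st fc sL Lt.
have := derive_ge0_of_left_max (fD _ (lt_trans as_ st1)) st1.
move=> /(_ _)/wrap[u su ut|]; first by rewrite t1E ltW// before.
by apply/negP; rewrite -ltNge dfneg ?t1E// ltW.
Qed.

(** The arithmetic of radial_decay: r is t * k', while a, b, m, z and d stand for
    t |v|, |w|, |t v + (alpha - 1) w|, |y - c - N w| and the scalar product of
    the last two vectors. All terms except N * _ are at most a constant times k,
    and N compares the sum of these constants to lam. *)
Lemma drift_bound (lam alpha C N k a b r m z d L : R) :
  0 < lam -> 2 * lam <= alpha - 1 -> 0 <= C -> 0 < k ->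
  0 <= b -> 0 <= m ->
  a ^+ 2 <= 2 * (C * k) -> b ^+ 2 = 2 * k -> r <= a * b ->
  L <= C * k + lam * r + lam * (alpha - 1) * k ->
  m <= a + (alpha - 1) * b -> z <= b -> - (m * z) <= d ->
  lam * N = 3 * C + 4 * alpha + lam^-1 * C ->
  N * (r + (alpha - 1) * (2 * k)) + d <= r + (alpha - 1) * k + lam^-1 * L ->
  r <= - (3 * lam * k).
Proof.
move=> l0 la C0 k0 b0 m0 a2 b2 rab LE mE zb dE NE.
have l0V : 0 < lam^-1 by rewrite invr_gt0.
have ab : a * b <= (C + 1) * k by have := sqr_ge0 (a - b); lra.
have r_le : r <= (C + 1) * k by exact: le_trans ab.
have L_le : lam^-1 * L <= lam^-1 * C * k + (r + (alpha - 1) * k).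
  rewrite ler_pdivrMl//; apply: (le_trans LE).
  by rewrite le_eqVlt; apply/orP; left; apply/eqP; field; rewrite gt_eqF.
have mz : m * z <= (C + 2 * alpha - 1) * k.
  apply: (@le_trans _ _ (m * b)); first by rewrite ler_wpM2l.
  apply: le_trans (ler_wpM2r b0 mE) _; rewrite mulrDl -mulrA -expr2 b2.
  by move: ab; clear; lra.
move=> chord.
have N0 : 0 < N.
  rewrite -(pmulr_rgt0 _ l0) NE; have := mulr_ge0 (ltW l0V) C0.
  by move: l0 la C0; clear; lra.
have : N * (r + (alpha - 1) * (2 * k)) <= N * (lam * k).
  rewrite [leRHS]mulrA (mulrC N lam) NE; move: chord L_le mz dE r_le k0; clear; lra.
rewrite ler_pM2l//.
have : 2 * lam * k <= (alpha - 1) * k by rewrite ler_pM2r.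
move: la k0; clear; lra.
Qed.

End Calculus.

(** * Minimizers of a convex function *)

Section Minimizers.
Context {R : realType} {n : nat}.
Variable F : 'rV[R]_n -> R.

Lemma argmin_inf_val c : argmin F c -> inf_val F = F c.
Proof.
move=> minc; apply/le_anti/andP; split.
  by apply: ge_inf; [exists (F c) => _ [y _ <-]; exact: minc | exists c].
by apply: lb_le_inf; [exists (F c), c | move=> _ [y _ <-]; exact: minc].
Qed.

Hypothesis Fconvex : convex_function [set: 'rV[R]_n] F.

Lemma convex_along c y (s : R) : 0 <= s <= 1 ->
  F (c + s *: (y - c)) <= F c + s * (F y - F c).
Proof.
move=> s01.
have := @Fconvex (Itv01 (andP s01).1 (andP s01).2) y c; rewrite !in_setT => /(_ isT isT).
rewrite !convRE /conv/=.
rewrite (_ : s *: y + _ = c + s *: (y - c)).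
  by rewrite /unstable.onem; lra.
by rewrite /unstable.onem scalerBl scale1r scalerBr addrCA.
Qed.

Lemma argmin_star c y (s : R) : argmin F c -> argmin F y -> 0 <= s <= 1 ->
  argmin F (c + s *: (y - c)).
Proof.
move=> minc miny s01 z.
have /le_trans := convex_along c y s01; apply.
have := miny c; have := minc z; have /andP[] := s01; have := minc y; nra.
Qed.

(** By convexity the difference quotients at y in the direction of c are at most
    F c - F y, and so is their limit. *)
Lemma gap_le_dot_grad c y : argmin F c -> differentiable F y ->
  F y - inf_val F <= dot (grad F y) (y - c).
Proof.
move=> minc Fy; suff : 'D_(c - y) F y <= F c - F y.
  rewrite deriveE// diff_grad// (argmin_inf_val minc) -(opprB c y) dotNr; lra.
rewrite leNgt; apply/negP => D0.
have : h^-1 *: ((F \o shift y) (h *: (c - y)) - F y) @[h --> 0^'] --> 'D_(c - y) F y.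
  exact: diff_derivable.
move=> /cvgr_gt/(_ _ D0)[e /= e0 He].
pose h := Num.min (e / 2) 1.
have h0 : 0 < h by rewrite lt_min ltr01 divr_gt0.
have he : h <= e / 2 by rewrite ge_min lexx.
have h1 : h <= 1 by rewrite ge_min lexx orbT.
have := He h; rewrite /ball_/= sub0r normrN gtr0_norm// => /(_ _ _)/wrap[].
  lra.
rewrite gt_eqF// => /(_ isT) Fh.
suff : h^-1 * (F (h *: (c - y) + y) - F y) <= F c - F y.
  by rewrite leNgt => /negP; apply.
rewrite mulrC ler_pdivrMr//.
have := @convex_along y c h; rewrite ltW// h1 => /(_ isT).
rewrite (addrC y); lra.
Qed.

End Minimizers.

(** * Energy along a trajectory *)

Section Trajectory.
Context {R : realType} {n : nat}.
Variables (F : 'rV[R]_n -> R) (alpha t0 : R) (x v : R -> 'rV[R]_n).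
Hypothesis Fconvex : convex_function [set: 'rV[R]_n] F.
Hypothesis Fdiff : forall y, differentiable F y.
Hypothesis t0_gt0 : 0 < t0.
Hypothesis xD : forall t, t0 < t -> is_derive t 1 x (v t).
Hypothesis vD : forall t, t0 < t ->
  is_derive t 1 v (- (alpha / t) *: v t - grad F (x t)).
Implicit Types c y z : 'rV[R]_n.

Definition gap t := F (x t) - inf_val F.
Definition kinetic t := dot (v t) (v t) / 2.
Definition energy t := gap t + kinetic t.
Definition halfdist c t := dot (x t - c) (x t - c) / 2.
Definition radial c t := dot (v t) (x t - c).
Definition gradwork c t := dot (grad F (x t)) (x t - c).

Lemma kinetic_ge0 t : 0 <= kinetic t.
Proof. by rewrite divr_ge0// dot_ge0. Qed.

Lemma halfdist_ge0 c t : 0 <= halfdist c t.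
Proof. by rewrite divr_ge0// dot_ge0. Qed.

Lemma gap_ge0 c t : argmin F c -> 0 <= gap t.
Proof. by move=> minc; rewrite subr_ge0 (argmin_inf_val minc). Qed.

Lemma energy_ge0 c t : argmin F c -> 0 <= energy t.
Proof. by move=> minc; rewrite addr_ge0 ?(gap_ge0 _ minc) ?kinetic_ge0. Qed.

Lemma gap_le_gradwork c t : argmin F c -> gap t <= gradwork c t.
Proof. by move=> minc; exact: gap_le_dot_grad. Qed.

Lemma enorm_v2 t : enorm (v t) ^+ 2 = 2 * kinetic t.
Proof. by rewrite enorm2 /kinetic; lra. Qed.

Lemma enorm_x2 c t : enorm (x t - c) ^+ 2 = 2 * halfdist c t.
Proof. by rewrite enorm2 /halfdist; lra. Qed.

Lemma xcD c t : t0 < t -> is_derive t 1 (fun s => x s - c) (v t).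
Proof.
move=> tt; have D := is_deriveB (xD tt) (is_derive_cst c t 1).
by apply: (is_derive_eq D); rewrite subr0.
Qed.

Lemma is_derive_energy t : t0 < t ->
  is_derive t 1 energy (- (2 * alpha / t) * kinetic t).
Proof.
move=> tt; have D1 := is_derive_along (Fdiff (x t)) (xD tt).
have D2 := is_deriveZf (1 / 2) (is_derive_dot (vD tt) (vD tt)).
have D3 := is_deriveDf (is_deriveDf D1 (is_derive_cst (- inf_val F) t 1)) D2.
have -> : energy = (fun s => F (x s) + cst (- inf_val F) s + 1 / 2 * dot (v s) (v s)).
  by apply/funext => s; rewrite /energy /gap /kinetic /cst/= mulrC mul1r.
apply: (is_derive_eq D3); rewrite /kinetic.
rewrite !(dotBl, dotBr, dotZl, dotZr) (dotC (v t) (grad _ _)).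
have t_gt0 : t != 0 by rewrite gt_eqF// (lt_trans t0_gt0).
field.
by [].
Qed.

Lemma is_derive_halfdist c t : t0 < t -> is_derive t 1 (halfdist c) (radial c t).
Proof.
move=> tt.
have D := is_deriveZf (1 / 2) (is_derive_dot (xcD c tt) (xcD c tt)).
have -> : halfdist c = (fun s => 1 / 2 * dot (x s - c) (x s - c)).
  by apply/funext => s; rewrite /halfdist mulrC mul1r.
by apply: (is_derive_eq D); rewrite /radial (dotC _ (v t)); lra.
Qed.

Lemma is_derive_radial c t : t0 < t ->
  is_derive t 1 (radial c) (2 * kinetic t - alpha / t * radial c t - gradwork c t).
Proof.
move=> tt; have D := is_derive_dot (vD tt) (xcD c tt).
apply: (is_derive_eq D); rewrite /radial /gradwork /kinetic dotBl dotZl; lra.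
Qed.

Lemma energy_nonincreasing s t : 0 <= alpha -> t0 < s -> s <= t ->
  energy t <= energy s.
Proof.
move=> a0 t0s st; apply: (nonincreasing_on is_derive_energy t0s st).
move=> u /andP[su _]; rewrite mulNr oppr_le0 mulr_ge0 ?kinetic_ge0//.
by rewrite divr_ge0 ?mulr_ge0// ltW// (lt_trans t0_gt0)// (lt_trans t0s).
Qed.

(** Weighing the decay of the energy by the inverse of the time: the function
    Phi below has derivative at most - energy t / t, and it is bounded below as
    soon as the trajectory is bounded; as dt / t has infinite mass, the energy
    cannot stay away from 0. *)
Lemma energy_vanishes c (B : R) : 0 < alpha -> argmin F c ->
  (forall t, t0 < t -> enorm (x t - c) <= B) ->
  forall eps : R, 0 < eps ->
    exists2 T : R, t0 < T & forall t, T <= t -> energy t <= eps.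
Proof.
move=> a0 minc xB eps eps0; apply: contrapT => /forall2NP nT.
have large t : t0 < t -> eps < energy t.
  move=> tt; have [//|/existsNP[s /not_implyP[ts /negP]]] := nT t.
  rewrite -ltNge => /lt_le_trans; apply.
  exact: energy_nonincreasing (ltW a0) tt ts.
pose Phi t := t^-1 * radial c t + (alpha + 1) * ((t^-1) ^+ 2 * halfdist c t)
  + 3 / (2 * alpha) * energy t.
have t1 : t0 < t0 + 1 by lra.
have PhiD u : t0 < u -> is_derive u 1 Phi (- (kinetic u + gradwork c u
    + 2 * (alpha + 1) * halfdist c u / u ^+ 2) / u).
  move=> tu; have u0 : u != 0 by rewrite gt_eqF// (lt_trans t0_gt0).
  have V : is_derive u 1 (fun s : R => s^-1) (- u ^- 2).
    by apply: (is_derive_eq (is_deriveV u0 (is_derive_id u (1 : R)))); exact: mulr1.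
  have V2 := is_deriveMf V V.
  have D1 := is_deriveMf V (is_derive_radial c tu).
  have D2 := is_deriveZf (alpha + 1) (is_deriveMf V2 (is_derive_halfdist c tu)).
  have D3 := is_deriveZf (3 / (2 * alpha)) (is_derive_energy tu).
  apply: (is_derive_eq (is_deriveDf (is_deriveDf D1 D2) D3)).
  by field; rewrite u0 gt_eqF.
set M := - (t0^-1 * ((energy (t0 + 1) + 1) * B)).
have Phi1D u (tu : t0 + 1 < u) := PhiD u (lt_trans t1 tu).
have [||t tt] := unbounded_below_halfline _ eps0 Phi1D _ M.
- by rewrite addr_ge0// ltW.
- move=> u tu; have u0 : 0 < u by rewrite (lt_trans t0_gt0)// (lt_trans t1).
  rewrite -mulNr ler_wpM2r ?invr_ge0 ?(ltW u0)// lerN2.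
  have h : 0 <= 2 * (alpha + 1) * halfdist c u / u ^+ 2.
    apply: divr_ge0 (sqr_ge0 _); apply: mulr_ge0 (halfdist_ge0 _ _); lra.
  have := gap_le_gradwork u minc; have := large _ (lt_trans t1 tu).
  by rewrite /energy; lra.
apply/negP; rewrite -leNgt /Phi /M.
have tt0 := lt_trans t1 tt.
have tp : 0 < t by exact: lt_trans tt0.
have e1 : 0 <= energy (t0 + 1) by rewrite ltW// (lt_trans eps0)// large.
have vM : enorm (v t) <= energy (t0 + 1) + 1.
  have := energy_nonincreasing (ltW a0) t1 (ltW tt).
  have := gap_ge0 t minc; have := enorm_v2 t; have := enorm_ge0 (v t).
  rewrite /energy; nra.
have rM : - ((energy (t0 + 1) + 1) * B) <= radial c t.
  have := normr_dot (v t) (x t - c); rewrite ler_norml => /andP[+ _].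
  apply: le_trans; rewrite lerN2; apply: ler_pM; rewrite ?enorm_ge0//.
  exact: xB.
have h1 : 0 <= (alpha + 1) * ((t^-1) ^+ 2 * halfdist c t).
  apply: mulr_ge0; first by lra.
  exact: mulr_ge0 (sqr_ge0 _) (halfdist_ge0 _ _).
have h2 : 0 <= 3 / (2 * alpha) * energy t.
  apply: mulr_ge0; first by rewrite divr_ge0 ?mulr_ge0 ?(ltW a0).
  by rewrite ltW// (lt_trans eps0)// large.
have B0 : 0 <= (energy (t0 + 1) + 1) * B.
  by apply: mulr_ge0; [rewrite addr_ge0 | exact: le_trans (enorm_ge0 _) (xB _ tt0)].
suff : - (t0^-1 * ((energy (t0 + 1) + 1) * B)) <= t^-1 * radial c t by lra.
rewrite -mulrN; apply: (@le_trans _ _ (t^-1 * - ((energy (t0 + 1) + 1) * B))).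
  rewrite !mulrN lerN2 ler_wpM2r// lef_pV2 ?posrE//; exact: ltW.
by rewrite ler_wpM2l// invr_ge0 ltW.
Qed.

(** * Convergence to a minimizer *)

Definition flat_ball (gamma : R) c (eta : R) :=
  forall y, enorm (y - c) < eta ->
    gamma * (F y - inf_val F) <= dot (grad F y) (y - c).

Section Capture.
Variables (gamma lam : R).
Hypothesis lam_gt0 : 0 < lam.
Hypothesis lam_gamma : gamma * lam = 2 * lam + 2.
Hypothesis lam_alpha : 2 * lam <= alpha - 1.

Definition lyap c t := t ^+ 2 * energy t + lam * (t * radial c t)
  + lam * (alpha - 1) * halfdist c t.

Lemma is_derive_lyap c t : t0 < t -> is_derive t 1 (lyap c)
  (t * (2 * gap t - 2 * (alpha - 1 - lam) * kinetic t - lam * gradwork c t)).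
Proof.
move=> tt; have t_neq0 : t != 0 by rewrite gt_eqF// (lt_trans t0_gt0).
have D1 := is_deriveMf (is_derive_sqr t) (is_derive_energy tt).
have D2 := is_deriveZf lam
  (is_deriveMf (is_derive_id t (1 : R)) (is_derive_radial c tt)).
have D3 := is_deriveZf (lam * (alpha - 1)) (is_derive_halfdist c tt).
apply: (is_derive_eq (is_deriveDf (is_deriveDf D1 D2) D3)).
by rewrite /energy; field.
Qed.

(** Flatness brings - (2 * lam + 2) * gap t, of which 2 * gap t only compensates
    the derivative of the weight t ^+ 2. *)
Lemma lyap_decay c eta t : argmin F c -> flat_ball gamma c eta -> t0 < t ->
  enorm (x t - c) < eta ->
  t * (2 * gap t - 2 * (alpha - 1 - lam) * kinetic t - lam * gradwork c t)
    <= - (2 * lam * (t * energy t)).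
Proof.
move=> minc Hc tt xc; have t_gt0 : 0 < t by exact: lt_trans tt.
have -> : - (2 * lam * (t * energy t)) = t * (- (2 * lam * energy t)) by ring.
rewrite ler_pM2l// /energy.
have := Hc _ xc; rewrite -/(gap t) -/(gradwork c t) => h.
have h1 : lam * (gamma * gap t) <= lam * gradwork c t by rewrite ler_pM2l.
have h2 : lam * (gamma * gap t) = (2 * lam + 2) * gap t.
  by rewrite mulrA (mulrC lam) lam_gamma.
have h3 : lam * kinetic t <= (alpha - 1 - lam) * kinetic t.
  by apply: ler_wpM2r; [exact: kinetic_ge0 | have := lam_alpha; lra].
lra.
Qed.

Lemma radial_bound c t : `|radial c t| <= enorm (v t) * enorm (x t - c).
Proof. exact: normr_dot. Qed.

Lemma lyap_lower_bound c t : 0 < t ->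
  t ^+ 2 * energy t - lam * (t * (enorm (v t) * enorm (x t - c)))
    + lam ^+ 2 * enorm (x t - c) ^+ 2 <= lyap c t.
Proof.
move=> t_gt0; rewrite /lyap -addrA [leRHS]addrAC -[leRHS]addrA lerD2l enorm_x2.
rewrite [leRHS]addrC; apply: lerD.
  rewrite -mulrN ler_pM2l// -mulrN ler_pM2l//.
  by have := radial_bound c t; rewrite ler_norml => /andP[].
rewrite [leLHS](_ : _ = lam * (2 * lam) * halfdist c t); last by ring.
by rewrite ler_wpM2r ?halfdist_ge0// ler_pM2l.
Qed.

(** This bound and the next one complete a square in lyap_lower_bound, where the
    coefficient lam ^+ 2 comes from the condition alpha - 1 >= 2 * lam. *)
Lemma lyap_ge_energy c t : argmin F c -> 0 < t ->
  t ^+ 2 * energy t <= 2 * lyap c t.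
Proof.
move=> minc t_gt0; have := lyap_lower_bound c t_gt0; rewrite /energy.
have := mulr_ge0 (sqr_ge0 t) (gap_ge0 t minc); have := enorm_v2 t.
have := sqr_ge0 (t * enorm (v t) / 2 - lam * enorm (x t - c)).
by move: (enorm (v t)) => a h1 aE; have -> : kinetic t = a ^+ 2 / 2; lra.
Qed.

Lemma lyap_ge_halfdist c t : argmin F c -> 0 < t ->
  lam ^+ 2 * halfdist c t <= lyap c t.
Proof.
move=> minc t_gt0; have := lyap_lower_bound c t_gt0; rewrite /energy.
have := mulr_ge0 (sqr_ge0 t) (gap_ge0 t minc); have := enorm_v2 t.
have := sqr_ge0 (t * enorm (v t) - lam * enorm (x t - c)).
have : lam ^+ 2 * enorm (x t - c) ^+ 2 = lam ^+ 2 * (2 * halfdist c t).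
  by rewrite enorm_x2.
by move: (enorm (v t)) => a kE h1 aE; have -> : kinetic t = a ^+ 2 / 2; lra.
Qed.

(** A trajectory that starts close to c, with a value of t ^+ 2 * energy t that
    is almost minimal in the future, remains in the ball. On the first exit time
    radial c is nonnegative and halfdist c is large, so that the decay of lyap c
    would have made t ^+ 2 * energy t smaller than that minimum. The linear term
    in the displacement makes the estimate uniform in the size mu ^+ 2 of this
    value. *)
Lemma no_exit c (eta rho s mu delta : R) : argmin F c -> flat_ball gamma c eta ->
  rho < eta -> 0 < rho -> t0 < s -> 0 <= mu -> delta <= 1 ->
  (forall t, s <= t -> mu ^+ 2 <= t ^+ 2 * energy t) ->
  (forall t, s <= t -> s ^+ 2 * energy s - delta <= t ^+ 2 * energy t) ->
  s ^+ 2 * energy s <= mu ^+ 2 + delta ->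
  3 * enorm (x s - c) <= rho ->
  delta + 2 * lam * enorm (x s - c) < lam * (alpha - 1) * rho ^+ 2 / 9 ->
  forall t, s <= t -> enorm (x t - c) < rho.
Proof.
move=> minc Hc rho_eta rho0 ts mu0 delta1 mu_le q_le q_s r_rho small t st.
rewrite ltNge; apply/negP => rho_t.
have la := lam_alpha; have l0 := lam_gt0; have tp := t0_gt0.
have s0 : 0 < s by exact: lt_trans ts.
have sqr_half u : enorm (x u - c) < rho <-> halfdist c u < rho ^+ 2 / 2.
  by have := enorm_x2 c u; have := enorm_ge0 (x u - c); split; nra.
have [t1 [st1 t1t t1E t1before]] : exists t1, [/\ s < t1, t1 <= t,
    halfdist c t1 = rho ^+ 2 / 2 &
    forall u, s <= u -> u < t1 -> halfdist c u < rho ^+ 2 / 2].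
  apply: first_passage => //.
  - move=> u; rewrite in_itv/= => /andP[su _].
    exact: is_derive_continuous (is_derive_halfdist c (lt_le_trans ts su)).
  - by apply/sqr_half; have := enorm_ge0 (x s - c); lra.
  - by rewrite leNgt; apply/negP => /sqr_half; rewrite ltNge rho_t.
have t1t0 : t0 < t1 by exact: lt_trans st1.
have t1_gt0 : 0 < t1 by exact: lt_trans t1t0.
have rad1 : 0 <= radial c t1.
  apply: (derive_ge0_of_left_max (is_derive_halfdist c t1t0) st1) => u su ut.
  by rewrite t1E ltW// t1before.
have rho_t1 : enorm (x t1 - c) = rho.
  have := enorm_x2 c t1; have := enorm_ge0 (x t1 - c); rewrite t1E; nra.
(* the displacement is measured along the direction of exit *)
pose theta := rho^-1 *: (x t1 - c).
have theta1 : enorm theta = 1.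
  by rewrite enormZ rho_t1 gtr0_norm ?invr_gt0// mulVf// gt_eqF.
pose f t := lyap c t + lam * mu * dot (x t - c) theta.
have fD u : t0 < u -> is_derive u 1 f
    (u * (2 * gap u - 2 * (alpha - 1 - lam) * kinetic u - lam * gradwork c u)
     + lam * mu * dot (v u) theta).
  move=> tu; have D := is_derive_dot (xcD c tu) (is_derive_cst theta u (1 : R)).
  apply: (is_derive_eq (is_deriveDf (is_derive_lyap c tu)
    (is_deriveZf (lam * mu) D))).
  by rewrite dotr0 addr0.
have ft1 : f t1 <= f s.
  apply: (nonincreasing_on fD ts (ltW st1)) => u /andP[su ut].
  have tu := lt_trans ts su; have u0 := lt_trans t0_gt0 tu.
  have xu : enorm (x u - c) < eta.
    by apply: lt_trans rho_eta; apply/sqr_half/t1before => //; exact: ltW.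
  have := lyap_decay minc Hc tu xu.
  have muu := mu_le _ (ltW su).
  have e0 : 0 <= energy u.
    rewrite -(@pmulr_rge0 _ (u ^+ 2)) ?exprn_gt0//.
    exact: le_trans (sqr_ge0 mu) muu.
  have mv : mu * enorm (v u) <= 2 * (u * energy u).
    have := enorm_v2 u; have := gap_ge0 u minc; have := enorm_ge0 (v u).
    rewrite -[kinetic u](addKr (gap u)) -/(energy u) => v0 g0 vE.
    have vv : enorm (v u) ^+ 2 <= 2 * energy u by rewrite vE; lra.
    have ue : 0 <= 2 * (u * energy u) by rewrite !mulr_ge0// ltW.
    apply: le_of_sqr => //; rewrite exprMn.
    apply: (@le_trans _ _ (u ^+ 2 * energy u * (2 * energy u))).
      by apply: ler_pM => //; exact: sqr_ge0.
    have := sqr_ge0 (u * energy u); lra.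
  have := dot_le_enorm (v u) theta; rewrite theta1 mulr1 => vth.
  have h : lam * mu * dot (v u) theta <= lam * (mu * enorm (v u)).
    by rewrite -mulrA ler_pM2l// ler_wpM2l.
  have h' : lam * (mu * enorm (v u)) <= lam * (2 * (u * energy u)).
    by rewrite ler_pM2l.
  lra.
have th1 : dot (x t1 - c) theta = rho.
  by rewrite dotZr -enorm2 rho_t1 expr2 mulrA mulVf ?mul1r// gt_eqF.
have ths : dot (x s - c) theta <= enorm (x s - c).
  by have := dot_le_enorm (x s - c) theta; rewrite theta1 mulr1.
have rads : radial c s <= enorm (v s) * enorm (x s - c).
  exact: dot_le_enorm.
have q1 := q_le _ (ltW st1).
have sv : s * enorm (v s) <= 2 * (mu + 1).
  have := enorm_v2 s; have := gap_ge0 s minc; have := enorm_ge0 (v s).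
  move=> v0 g0 vE.
  apply: le_of_sqr; first by lra.
  rewrite exprMn vE.
  have h : 0 <= s ^+ 2 * gap s by rewrite mulr_ge0 ?sqr_ge0.
  have := sqr_ge0 mu; move: q_s; rewrite /energy; lra.
move: ft1; rewrite /f /lyap th1 t1E.
have := enorm_x2 c s.
have r0 := enorm_ge0 (x s - c).
move: (enorm (x s - c)) r0 ths rads r_rho small sv => r r0 ths rads r_rho small sv kE.
have h1 : lam * mu * dot (x s - c) theta <= lam * mu * r.
  by rewrite ler_wpM2l// mulr_ge0// ltW.
have h2 : lam * (s * radial c s) <= lam * (2 * (mu + 1) * r).
  rewrite ler_pM2l//; apply: (@le_trans _ _ (s * (enorm (v s) * r))).
    by rewrite ler_pM2l.
  by rewrite mulrA ler_wpM2r.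
have h3 : 0 <= lam * (t1 * radial c t1) by rewrite !mulr_ge0// ltW.
have h4 : 0 <= lam * mu * (rho - 3 * r).
  by apply: mulr_ge0; [rewrite mulr_ge0// ltW | lra].
have h5 : 0 < lam * (alpha - 1) by apply: mulr_gt0 => //; lra.
have h6 : lam * (alpha - 1) * (9 * r ^+ 2) <= lam * (alpha - 1) * rho ^+ 2.
  rewrite ler_pM2l//; nra.
have -> : halfdist c s = r ^+ 2 / 2 by lra.
nra.
Qed.

Lemma lyap_nonincreasing c eta T s t : argmin F c -> flat_ball gamma c eta ->
  t0 < T -> (forall u, T <= u -> enorm (x u - c) < eta) -> T <= s -> s <= t ->
  lyap c t <= lyap c s.
Proof.
move=> minc Hc tT near_c Ts st.
have ts : t0 < s by exact: lt_le_trans Ts.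
apply: (nonincreasing_on (is_derive_lyap c) ts st) => u /andP[su _].
have tu := lt_trans ts su; have u0 := lt_trans t0_gt0 tu.
apply: (le_trans (lyap_decay minc Hc tu (near_c _ (le_trans Ts (ltW su))))).
rewrite oppr_le0; apply: mulr_ge0; first by rewrite mulr_ge0// ltW.
exact: mulr_ge0 (ltW u0) (energy_ge0 u minc).
Qed.

(** Otherwise the nonnegative function lyap c would decrease at rate at least
    2 * lam * kappa / t, which is not integrable. *)
Lemma energy_liminf c eta T kappa : argmin F c -> flat_ball gamma c eta ->
  t0 < T -> (forall u, T <= u -> enorm (x u - c) < eta) -> 0 < kappa ->
  exists2 t, T <= t & t ^+ 2 * energy t < kappa.
Proof.
move=> minc Hc tT near_c k0; apply: contrapT => /forall2NP nq.
have large t : T <= t -> kappa <= t ^+ 2 * energy t.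
  by move=> Tt; rewrite leNgt; apply/negP; case: (nq t).
have k1 : 0 < 2 * lam * kappa by rewrite !mulr_gt0.
have lD u (Tu : T < u) := is_derive_lyap c (lt_trans tT Tu).
have [||t Tt] := unbounded_below_halfline _ k1 lD _ 0.
- by rewrite ltW// (lt_trans t0_gt0).
- move=> u Tu; have tu := lt_trans tT Tu; have u0 := lt_trans t0_gt0 tu.
  apply: (le_trans (lyap_decay minc Hc tu (near_c _ (ltW Tu)))).
  rewrite lerN2 ler_pdivrMr// (_ : _ * u = 2 * lam * (u ^+ 2 * energy u)); last by ring.
  by rewrite ler_wpM2l ?mulr_ge0 ?(ltW lam_gt0)// large// ltW.
have tp : 0 < t by rewrite (lt_trans t0_gt0)// (lt_trans tT).
apply/negP; rewrite -leNgt; apply: le_trans (lyap_ge_halfdist minc tp).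
by rewrite mulr_ge0 ?halfdist_ge0 ?sqr_ge0.
Qed.

(** The infimum of t ^+ 2 * energy t over a half-line need not be attained. *)
Lemma almost_minimal_time c (j : nat) : argmin F c ->
  exists s : R, t0 + j.+1%:R <= s /\
    forall t : R, s <= t -> s ^+ 2 * energy s - j.+1%:R^-1 <= t ^+ 2 * energy t.
Proof.
move=> minc; pose A := [set t ^+ 2 * energy t | t in [set t | t0 + j.+1%:R <= t]].
have hA : has_inf A.
  split; first by exists ((t0 + j.+1%:R) ^+ 2 * energy (t0 + j.+1%:R)), (t0 + j.+1%:R) => //=.
  exists 0 => _ [t _ <-]; rewrite mulr_ge0 ?sqr_ge0//; exact: energy_ge0 minc.
have j0 : 0 < (j.+1%:R : R)^-1 by rewrite invr_gt0 ltr0n.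
have [_ [s /= js <-] sA] := inf_adherent j0 hA.
exists s; split=> // t st.
have : inf A <= t ^+ 2 * energy t.
  by apply: ge_inf; [case: hA | exists t => //=; exact: le_trans st].
by move=> h; rewrite lerBlDr; apply: (le_trans (ltW sA)); rewrite lerD2r.
Qed.

Hypothesis flat : forall c, argmin F c ->
  exists2 eta : R, 0 < eta & flat_ball gamma c eta.

(** The limit is a cluster point of the trajectory along almost minimal times of
    t ^+ 2 * energy t; the trajectory is then trapped near it, and these minimal
    values tend to 0 by energy_liminf, so that lyap c is arbitrarily small at
    some time and decreases from then on. *)
Lemma capture (c0 : 'rV[R]_n) (B : R) : argmin F c0 ->
  (forall t, t0 < t -> enorm (x t) <= B) ->
  exists2 c, argmin F c & forall eps : R, 0 < eps ->
    exists2 T : R, t0 < T & forall t, T <= t -> lyap c t <= eps.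
Proof.
move=> minc0 xB; have la := lam_alpha; have l0 := lam_gt0; have tp := t0_gt0.
have a0 : 0 < alpha by lra.
have [s /all_and2[js qs]] := choice (fun j => almost_minimal_time j minc0).
have ts j : t0 < s j by rewrite (lt_le_trans _ (js j))// ltrDl ltr0n.
have [c cl] := bounded_seq_cluster (fun j => xB (s j) (ts j)).
have sT T j : (Num.truncn T <= j)%N -> T <= s j.
  move=> Tj; apply: le_trans (js j); apply: (@le_trans _ _ j.+1%:R).
    by apply: ltW (lt_le_trans (truncnS_gt _) _); rewrite ler_nat.
  by rewrite lerDr ltW.
have inv_small (e : R) : 0 < e -> exists J, forall j, (J <= j)%N -> j.+1%:R^-1 < e.
  move=> e0; exists (Num.truncn e^-1) => j Jj.
  rewrite invf_plt ?posrE ?ltr0n//; apply: lt_le_trans (truncnS_gt _) _.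
  by rewrite ler_nat.
have minc : argmin F c.
  move=> y; apply: le_trans (minc0 y); apply/ler_addgt0Pr => e e0.
  have e2 : 0 < e / 2 by lra.
  have xcB t : t0 < t -> enorm (x t - c0) <= B + enorm c0.
    move=> tt; apply: le_trans (ler_enormD _ _) _.
    by rewrite enormN lerD2r xB.
  have [T tT Te] := energy_vanishes a0 minc0 xcB e2.
  have Fc : nbhs c (fun z => `|F c - F z| < e / 2).
    exact: (cvgrPdist_lt _ _).1 (differentiable_continuous (Fdiff c)) _ e2.
  have [d /= d0 Fd] := (nbhs_ballP _ _).1 Fc.
  have [j Tj cj] := cl d (Num.truncn T) d0.
  have : `|F c - F (x (s j))| < e / 2.
    apply: Fd; rewrite -ball_normE /ball_/= distrC.
    exact: le_lt_trans (normr_le_enorm _) cj.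
  have := Te _ (sT _ _ Tj); have := kinetic_ge0 (s j).
  rewrite ltr_norml /energy /gap (argmin_inf_val minc0); lra.
have [eta eta0 Hc] := flat minc.
pose rho : R := eta / 2.
have rho0 : 0 < rho by rewrite divr_gt0.
have rho_eta : rho < eta by rewrite /rho; lra.
pose e1 := lam * (alpha - 1) * rho ^+ 2 / 9.
have e10 : 0 < e1.
  by rewrite divr_gt0// !mulr_gt0//; lra.
have e12 : 0 < e1 / 2 by rewrite divr_gt0.
have [J HJ] := inv_small _ e12.
have r0 : 0 < Num.min (rho / 3) (e1 / (4 * lam)).
  by rewrite lt_min; apply/andP; split; apply: divr_gt0 => //; rewrite mulr_gt0.
have [j Jj] := cl _ J r0.
rewrite lt_min => /andP[r1 r2].
have {}r2 : 4 * lam * enorm (x (s j) - c) < e1.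
  by rewrite mulrC -ltr_pdivlMr// mulr_gt0.
have q0 t : 0 <= t ^+ 2 * energy t.
  by rewrite mulr_ge0 ?sqr_ge0//; exact: energy_ge0 minc.
have near_c t : s j <= t -> enorm (x t - c) < rho.
  set q := s j ^+ 2 * energy (s j); set delta : R := j.+1%:R^-1.
  have musq : Num.sqrt (Num.max 0 (q - delta)) ^+ 2 = Num.max 0 (q - delta).
    by rewrite sqr_sqrtr// le_max lexx.
  apply: (@no_exit c eta rho (s j) (Num.sqrt (Num.max 0 (q - delta))) delta) => //.
  - by rewrite /delta invf_le1 ?ltr0n// ler1n.
  - by move=> u su; rewrite musq ge_max q0 qs.
  - by exact: qs.
  - rewrite musq -lerBlDr le_max lexx orbT//.
  - lra.
  - by move: (HJ _ Jj); rewrite -/delta -/e1; move: (delta) => dl; lra.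
have near_eta t (st : s j <= t) := lt_trans (near_c t st) rho_eta.
exists c => // eps eps0.
have q_small i : s j <= s i -> s i ^+ 2 * energy (s i) <= 2 * i.+1%:R^-1.
  move=> ji; have i0 : 0 < (i.+1%:R : R)^-1 by rewrite invr_gt0 ltr0n.
  have [t it qt] := energy_liminf minc Hc (ts i)
    (fun u iu => near_eta u (le_trans ji iu)) i0.
  by move: qt (qs i _ it); move: (i.+1%:R^-1 : R) => z; lra.
set K := 2 * lam + lam * (alpha - 1).
have K0 : 0 < K by rewrite addr_gt0 ?mulr_gt0//; lra.
have eps4 : 0 < eps / 4 by rewrite divr_gt0.
have [J1 HJ1] := inv_small _ eps4.
have r'0 : 0 < Num.min 1 (eps / (2 * K)).
  by rewrite lt_min ltr01; apply: divr_gt0 => //; rewrite mulr_gt0.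
have [i Ji] := cl _ (maxn J1 (Num.truncn (s j))) r'0.
move: Ji; rewrite geq_max lt_min => /andP[J1i si] /andP[r3 r4].
have ji := sT _ _ si.
exists (s i) => // t it.
apply: le_trans (lyap_nonincreasing minc Hc (ts i)
  (fun u iu => near_eta u (le_trans ji iu)) (lexx _) it) _.
have si0 : 0 < s i by exact: lt_trans (ts i).
have := q_small _ ji; have := HJ1 _ J1i.
have i1 : (i.+1%:R : R)^-1 <= 1 by rewrite invf_le1 ?ltr0n// ler1n.
have sv : s i * enorm (v (s i)) <= 2.
  have := q_small _ ji; have := enorm_v2 (s i); have := gap_ge0 (s i) minc.
  move=> g0 vE; rewrite /energy => qi.
  have h : 0 <= s i ^+ 2 * gap (s i) by rewrite mulr_ge0 ?sqr_ge0.
  apply: le_of_sqr => //; rewrite exprMn vE.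
  move: i1 qi; move: (i.+1%:R^-1 : R) => z; lra.
have rads := dot_le_enorm (v (s i)) (x (s i) - c); rewrite -/(radial c (s i)) in rads.
rewrite /lyap; have := enorm_x2 c (s i).
have {}r4 : K * enorm (x (s i) - c) < eps / 2.
  have : eps / (2 * K) * K = eps / 2 by field; rewrite gt_eqF.
  by move=> <-; rewrite mulrC ltr_pM2r.
have r5 := enorm_ge0 (x (s i) - c).
move: (enorm (x (s i) - c)) r3 r4 r5 rads => r r3 r4 r5 rads kE h1 h2.
have h3 : lam * (s i * radial c (s i)) <= lam * (2 * r).
  rewrite ler_pM2l//; apply: (@le_trans _ _ (s i * (enorm (v (s i)) * r))).
    by rewrite ler_pM2l.
  by rewrite mulrA ler_wpM2r.
have h4 : halfdist c (s i) <= r by nra.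
have h5 : lam * (alpha - 1) * halfdist c (s i) <= lam * (alpha - 1) * r.
  by rewrite ler_wpM2l// mulr_ge0 ?(ltW l0)//; lra.
by move: h1 h2; rewrite /K in r4; move: (i.+1%:R^-1 : R) => z; lra.
Qed.

(** * Decay rate of the energy *)

Lemma vanishing c T : argmin F c -> t0 < T ->
  (forall eps : R, 0 < eps ->
     exists2 T : R, t0 < T & forall t, T <= t -> lyap c t <= eps) ->
  forall eps : R, 0 < eps -> exists2 T' : R, T <= T' & forall t, T' <= t ->
    t * enorm (v t) <= eps /\ enorm (x t - c) <= eps.
Proof.
move=> minc tT lyap0 eps eps0; have l0 := lam_gt0.
have d0 : 0 < Num.min (eps ^+ 2 / 4) (lam ^+ 2 * eps ^+ 2 / 2).
  by rewrite lt_min; apply/andP; split; rewrite divr_gt0 ?mulr_gt0 ?exprn_gt0.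
have [T1 tT1 HT1] := lyap0 _ d0.
exists (Num.max T T1) => [|t]; first by rewrite le_max lexx.
rewrite ge_max => /andP[Tt T1t].
have t_gt0 : 0 < t by rewrite (lt_trans t0_gt0)// (lt_le_trans tT).
have := HT1 _ T1t; rewrite le_min => /andP[h1 h2].
have g0 : 0 <= t ^+ 2 * gap t by rewrite mulr_ge0 ?sqr_ge0 ?(gap_ge0 _ minc).
split; apply: le_of_sqr; rewrite ?(ltW eps0)//.
  have := lyap_ge_energy minc t_gt0; rewrite exprMn enorm_v2 /energy; lra.
have := lyap_ge_halfdist minc t_gt0; rewrite enorm_x2 => h.
have : lam ^+ 2 * (2 * halfdist c t) <= lam ^+ 2 * eps ^+ 2 by lra.
by rewrite ler_pM2l// exprn_gt0.
Qed.

(** With w = x t - c this is t ^+ 2 * gap t plus half of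
    enorm (lam *: w + t *: v t) ^+ 2 - lam * (alpha - 1 - lam) * enorm w ^+ 2.
    The negative coefficient makes the sign of the function unknown, but is what
    allows for a weight with the optimal exponent. *)
Definition rlyap c t := t ^+ 2 * energy t + lam * (t * radial c t)
  - lam * (alpha - 1 - 2 * lam) * halfdist c t.

(** The exponent of the weight is the largest one that the flatness of F
    compensates; the remaining terms form the square of the norm of
    t *: v t + lam *: (x t - c). *)
Lemma weighted_rlyap_nonincreasing c eta T s t : argmin F c ->
  flat_ball gamma c eta ->
  t0 < T -> (forall u, T <= u -> enorm (x u - c) < eta) -> T <= s -> s <= t ->
  t `^ (2 * lam) * rlyap c t <= s `^ (2 * lam) * rlyap c s.
Proof.
move=> minc Hc tT near_c Ts st; have l0 := lam_gt0; have la := lam_alpha.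
pose E u := u `^ (2 * lam)
  * (lyap c u + (- (2 * lam * (alpha - 1 - lam))) * halfdist c u).
have EE u : u `^ (2 * lam) * rlyap c u = E u.
  by congr (_ * _); rewrite /rlyap /lyap; ring.
rewrite !EE; pose dE u := 2 * lam / u * u `^ (2 * lam)
   * (lyap c u + (- (2 * lam * (alpha - 1 - lam))) * halfdist c u)
  + u `^ (2 * lam)
   * (u * (2 * gap u - 2 * (alpha - 1 - lam) * kinetic u - lam * gradwork c u)
     + (- (2 * lam * (alpha - 1 - lam))) * radial c u).
have ED u : t0 < u -> is_derive u 1 E (dE u).
  move=> tu; have u0 := lt_trans t0_gt0 tu.
  apply: is_deriveMf; first exact: is_derive_powR.
  apply: is_deriveDf; first exact: is_derive_lyap.
  by apply: is_deriveZf; exact: is_derive_halfdist.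
apply: (nonincreasing_on ED (lt_le_trans tT Ts) st) => u /andP[su _].
have tu : t0 < u by rewrite (lt_trans (lt_le_trans tT Ts)).
have u0 := lt_trans t0_gt0 tu.
have flat_u : gamma * gap u <= gradwork c u.
  exact/Hc/near_c/(le_trans Ts (ltW su)).
have h1 : lam * (gamma * gap u) <= lam * gradwork c u by rewrite ler_pM2l.
have h2 : lam * (gamma * gap u) = (2 * lam + 2) * gap u.
  by rewrite mulrA (mulrC lam) lam_gamma.
have sq := dot_ge0 (u *: v u + lam *: (x u - c)).
rewrite dot_sqr_comb in sq.
have -> : dE u = u `^ (2 * lam) / u * (2 * lam
   * (lyap c u + (- (2 * lam * (alpha - 1 - lam))) * halfdist c u)
  + u * (u * (2 * gap u - 2 * (alpha - 1 - lam) * kinetic u - lam * gradwork c u)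
     + (- (2 * lam * (alpha - 1 - lam))) * radial c u)).
  by rewrite /dE; field; rewrite gt_eqF.
apply: mulr_ge0_le0; first by rewrite divr_ge0 ?powR_ge0 ?ltW.
have h3 : u ^+ 2 * (lam * (gamma * gap u)) <= u ^+ 2 * (lam * gradwork c u).
  by rewrite ler_wpM2l ?sqr_ge0.
have h4 : 0 <= (alpha - 1 - 2 * lam) * (u ^+ 2 * dot (v u) (v u)
    + 2 * u * lam * dot (v u) (x u - c) + lam ^+ 2 * dot (x u - c) (x u - c)).
  by apply: mulr_ge0; [lra | exact: sq].
rewrite h2 in h3; rewrite /lyap /energy; move: h4.
rewrite -/(radial c u).
have -> : dot (v u) (v u) = 2 * kinetic u by rewrite /kinetic; lra.
have -> : dot (x u - c) (x u - c) = 2 * halfdist c u by rewrite /halfdist; lra.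
lra.
Qed.

(** The scalar product radial c t is absorbed by half of the energy term. *)
Lemma energy_le_halfdist c t (D : R) : argmin F c -> 0 < t ->
  rlyap c t <= D ->
  t ^+ 2 * energy t <=
    (4 * lam ^+ 2 + 2 * lam * (alpha - 1 - 2 * lam)) * halfdist c t + 2 * D.
Proof.
move=> minc t_gt0; rewrite /rlyap /energy.
have := radial_bound c t; rewrite ler_norml => /andP[+ _].
have := enorm_v2 t; have := enorm_x2 c t; have := gap_ge0 t minc.
have l0 := lam_gt0.
move: (enorm (v t)) (enorm (x t - c)) (gap t) (kinetic t) (halfdist c t) (radial c t).
move=> a b g K k r g0 bE aE rab.
have h1 : lam * (t * (- (a * b))) <= lam * (t * r) by rewrite !ler_pM2l.
have h3 : 0 <= t ^+ 2 * g by rewrite mulr_ge0// sqr_ge0.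
have -> : K = a ^+ 2 / 2 by lra.
have -> : k = b ^+ 2 / 2 by lra.
have h4 := sqr_ge0 (t * a - 2 * lam * b).
lra.
Qed.

(** The function S below is nonincreasing: by convexity at y its derivative
    is at most 2 * t * kinetic t without the term in lyap c, and the decay of
    lyap c pays for that. Comparing S t with its limit at infinity, where x is at
    c, gives the claim. It expresses that the trajectory is not attracted towards
    c along the chords of the set of minimizers. *)
Lemma chord_inequality c y eta T t : argmin F c -> argmin F y ->
  flat_ball gamma c eta ->
  t0 < T -> (forall u, T <= u -> enorm (x u - c) < eta) ->
  (forall eps : R, 0 < eps ->
     exists2 T : R, t0 < T & forall t, T <= t -> lyap c t <= eps) ->
  T <= t ->
  dot (t *: v t + (alpha - 1) *: (x t - c)) (y - c) <=
    t * radial c t + (alpha - 1) * halfdist c t + lam^-1 * lyap c t.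
Proof.
move=> minc miny Hc tT near_c lyap0 Tt; have l0 := lam_gt0; have la := lam_alpha.
pose S u := u * radial y u + (alpha - 1) * halfdist y u + lam^-1 * lyap c u.
have S_le u : t <= u -> S u <= S t.
  move=> tu; pose dS u := 1 * radial y u
      + u * (2 * kinetic u - alpha / u * radial y u - gradwork y u)
    + (alpha - 1) * radial y u + lam^-1 * (u * (2 * gap u
        - 2 * (alpha - 1 - lam) * kinetic u - lam * gradwork c u)).
  have SD w : t0 < w -> is_derive w 1 S (dS w).
    move=> tw; apply: is_deriveDf; last by apply/is_deriveZf/is_derive_lyap.
    apply: is_deriveDf; last by apply/is_deriveZf/is_derive_halfdist.
    exact: is_deriveMf (is_derive_id w (1 : R)) (is_derive_radial y tw).
  apply: (nonincreasing_on SD (lt_le_trans tT Tt) tu) => w /andP[tw _].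
  have t0w : t0 < w by rewrite (lt_trans (lt_le_trans tT Tt)).
  have w0 := lt_trans t0_gt0 t0w.
  have -> : dS w = w * (2 * kinetic w - gradwork y w) + lam^-1 * (w * (2 * gap w
        - 2 * (alpha - 1 - lam) * kinetic w - lam * gradwork c w)).
    by rewrite /dS; field; rewrite !gt_eqF.
  have := lyap_decay minc Hc t0w (near_c _ (le_trans Tt (ltW tw))).
  rewrite -(ler_pM2l (x := lam^-1)) ?invr_gt0// => h.
  have : lam^-1 * - (2 * lam * (w * energy w)) = - (2 * (w * energy w)).
    by field; rewrite gt_eqF.
  move=> E; rewrite E in h.
  have gy := gap_le_gradwork w miny; have g0 := gap_ge0 w minc.
  have h1 : w * (- gradwork y w) <= 0.
    by rewrite mulrN oppr_le0; exact: mulr_ge0 (ltW w0) (le_trans g0 gy).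
  have h2 := mulr_ge0 (ltW w0) g0.
  move: h; rewrite /energy; lra.
have z2 u : halfdist y u = halfdist c u - dot (x u - c) (y - c)
    + enorm (y - c) ^+ 2 / 2.
  have -> : halfdist y u = dot (1 *: (x u - c) + -1 *: (y - c))
      (1 *: (x u - c) + -1 *: (y - c)) / 2.
    by rewrite scale1r scaleN1r opprB subrKA.
  by rewrite dot_sqr_comb enorm2 /halfdist; lra.
have rad u : radial y u = radial c u - dot (v u) (y - c).
  by rewrite /radial -(dotBr (v u) (x u - c)) opprB subrKA.
suff Slow : (alpha - 1) * (enorm (y - c) ^+ 2 / 2) <= S t.
  by move: Slow; rewrite /S z2 rad (dotDl (t *: v t)) !dotZl; lra.
apply/ler_addgt0Pr => e e0.
set Z := enorm (y - c).
have Z0 : 0 <= Z by exact: enorm_ge0.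
have W0 : 0 < 1 + Z + (alpha - 1) * Z.
  have : 0 <= (alpha - 1) * Z by apply: mulr_ge0 => //; lra.
  lra.
have m0 : 0 < Num.min 1 (e / (1 + Z + (alpha - 1) * Z)).
  by rewrite lt_min ltr01; apply: divr_gt0.
have [T' TT' HT'] := vanishing minc tT lyap0 m0.
pose u := Num.max t T'.
have tu : t <= u by rewrite le_max lexx.
have [] := HT' u; first by rewrite le_max lexx orbT.
have u0 : 0 < u by rewrite (lt_trans t0_gt0)// (lt_le_trans tT)// (le_trans Tt).
rewrite !le_min => /andP[a1 ae] /andP[b1 be].
apply: (le_trans _ (lerD (S_le _ tu) (lexx e))).
have ly : 0 <= lam^-1 * lyap c u.
  rewrite mulr_ge0 ?invr_ge0 ?(ltW l0)//.
  apply: le_trans (lyap_ge_halfdist minc u0).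
  by rewrite mulr_ge0 ?sqr_ge0 ?halfdist_ge0.
rewrite /S z2 rad -/Z; move: ly (halfdist_ge0 c u).
have := radial_bound c u; rewrite ler_norml => /andP[+ _].
have := dot_le_enorm (v u) (y - c); have := dot_le_enorm (x u - c) (y - c).
rewrite -/Z; have := enorm_ge0 (v u); have := enorm_ge0 (x u - c).
move: (enorm (v u)) (enorm (x u - c)) a1 ae b1 be => a b a1 ae b1 be b0 a0.
move: (dot (x u - c) (y - c)) (dot (v u) (y - c)) (radial c u) (halfdist c u).
move=> p1 p2 r k h1 h2 h3 h4 h5.
have ua0 : 0 <= u * a by exact: mulr_ge0 (ltW u0) a0.
have mulu r1 r2 : r1 <= r2 -> u * r1 <= u * r2 by rewrite ler_pM2l.
have := mulu _ _ h2; have := mulu _ _ h3.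
have h6 : 0 <= (alpha - 1) * k by apply: mulr_ge0 => //; lra.
have h7 : (alpha - 1) * p1 <= (alpha - 1) * (b * Z) by apply: ler_wpM2l => //; lra.
have h8 : u * a * b <= e / (1 + Z + (alpha - 1) * Z) * 1 by exact: ler_pM.
have h9 : u * a * Z <= e / (1 + Z + (alpha - 1) * Z) * Z by exact: ler_wpM2r.
have h10 : (alpha - 1) * (b * Z) <=
    (alpha - 1) * (e / (1 + Z + (alpha - 1) * Z) * Z).
  by apply: ler_wpM2l; [lra | exact: ler_wpM2r].
have h11 : e / (1 + Z + (alpha - 1) * Z) * (1 + Z + (alpha - 1) * Z) = e.
  by rewrite divfK// gt_eqF.
lra.
Qed.

(** Outside a ball of radius of order t `^ (- lam), the trajectory approaches c
    much faster than this radius decreases. There the growth of F puts the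
    trajectory close to the set of minimizers, which allows to apply the
    chord inequality to a minimizer near c + N *: (x t - c) with N large: the
    left-hand side is then about
    N * (t * radial c t + 2 * (alpha - 1) * halfdist c t),
    whereas the right-hand side is of order halfdist c t. *)
Lemma radial_decay c (eta T C K r : R) : argmin F c -> flat_ball gamma c eta ->
  t0 < T -> (forall u, T <= u -> enorm (x u - c) < eta) ->
  (forall eps : R, 0 < eps ->
     exists2 T : R, t0 < T & forall t, T <= t -> lyap c t <= eps) ->
  0 <= C -> (forall t, T <= t -> t `^ (2 * lam) * rlyap c t <= C) ->
  0 < K -> 0 < r ->
  (forall y, enorm (y - c) < r ->
     K * edistance y (argmin F) `^ gamma <= F y - inf_val F) ->
  exists A T', [/\ 0 < A, T <= T' & forall t, T' <= t ->
    A <= t `^ (2 * lam) * halfdist c t ->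
    [/\ t ^+ 2 * energy t <= (4 * lam ^+ 2 + 2 * lam * (alpha - 1 - 2 * lam) + 2)
          * halfdist c t
      & t * radial c t <= - (3 * lam * halfdist c t)]].
Proof.
move=> minc Hc tT near_c lyap0 C0 rC K0 r0 growth.
have la := lam_alpha; have l0 := lam_gt0; have tp := t0_gt0.
pose C1 := 4 * lam ^+ 2 + 2 * lam * (alpha - 1 - 2 * lam) + 2.
have C10 : 0 < C1.
  have h1 := sqr_ge0 lam.
  have h2 : 0 <= 2 * lam * (alpha - 1 - 2 * lam) by apply: mulr_ge0; lra.
  by rewrite /C1; lra.
pose N := (3 * C1 + 4 * alpha + lam^-1 * C1) / lam.
have NE : lam * N = 3 * C1 + 4 * alpha + lam^-1 * C1.
  by rewrite /N mulrC divfK// gt_eqF.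
have N0 : 0 < N.
  rewrite -(pmulr_rgt0 _ l0) NE.
  have : 0 < lam^-1 * C1 by rewrite mulr_gt0 ?invr_gt0.
  lra.
clearbody N.
have [e [rho [e0 rho0 prolong]]] := prolongation_near minc
  (fun p s minp s01 => argmin_star Fconvex minc minp s01) N0.
have gamma2 : (gamma - 2) * lam = 2 by have := lam_gamma; lra.
have gamma_gt2 : 2 < gamma.
  by rewrite -subr_gt0 -(pmulr_lgt0 _ l0) gamma2.
pose A5 := (C1 / 2 / (K * e `^ gamma)) `^ lam.
have A50 : 0 <= A5 by exact: powR_ge0.
have m0 : 0 < Num.min (rho / 2) (r / 2).
  by rewrite lt_min; apply/andP; split; apply: divr_gt0.
have [T' TT' HT'] := vanishing minc tT lyap0 m0.
exists (C + A5 + 1), T'; split=> //; first by lra.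
move=> t T't; have Tt := le_trans TT' T't.
have t_gt0 : 0 < t by rewrite (lt_trans t0_gt0)// (lt_le_trans tT).
have [_] := HT' t T't; rewrite le_min => /andP[w_rho w_r].
have P0 : 0 < t `^ (2 * lam) by exact: powR_gt0.
set P := t `^ (2 * lam) in P0 *; move=> AP.
have b2 := enorm_x2 c t; have b0 := enorm_ge0 (x t - c).
have rk : rlyap c t <= halfdist c t.
  by rewrite -(ler_pM2l P0); apply: le_trans (rC _ Tt) _; lra.
have q_le := energy_le_halfdist minc t_gt0 rk.
have {}q_le : t ^+ 2 * energy t <= C1 * halfdist c t by rewrite /C1; lra.
split; first exact: q_le.
have k0 : 0 < halfdist c t by rewrite -(pmulr_rgt0 _ P0); lra.
have b_gt0 : 0 < enorm (x t - c).
  by rewrite lt_def b0 andbT -sqrf_eq0 b2 gt_eqF// mulr_gt0.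
have tgap : 0 <= t ^+ 2 * gap t by rewrite mulr_ge0 ?sqr_ge0 ?(gap_ge0 _ minc).
have tkin : 0 <= t ^+ 2 * kinetic t by rewrite mulr_ge0 ?sqr_ge0 ?kinetic_ge0.
have near_argmin : edistance (x t) (argmin F) < e * enorm (x t - c).
  rewrite ltNge; apply/negP => far.
  have xr : enorm (x t - c) < r by lra.
  have tg : t ^+ 2 * gap t <= C1 / 2 * enorm (x t - c) ^+ 2.
    by rewrite b2; move: q_le; rewrite /energy; lra.
  have := rescaled_growth K0 e0 b_gt0 t_gt0 gamma_gt2 gamma2 (growth _ xr) tg far.
  by rewrite b2 -/A5 -/P; lra.
have [|y miny err] := prolong (x t) _ near_argmin.
  by apply: le_lt_trans w_rho _; lra.
have chord := chord_inequality minc miny Hc tT near_c lyap0 Tt.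
set z := y - c - N *: (x t - c) in err.
have yE : y - c = N *: (x t - c) + z by rewrite [RHS]addrC subrK.
pose m := t *: v t + (alpha - 1) *: (x t - c).
have zm : - (enorm m * enorm z) <= dot m z.
  by have := normr_dot m z; rewrite ler_norml => /andP[].
have mE : dot m (y - c) =
    N * (t * radial c t + (alpha - 1) * (2 * halfdist c t)) + dot m z.
  rewrite yE (dotDr m) (dotZr _ m) {1}/m (dotDl (t *: v t)) !dotZl.
  by rewrite -/(radial c t) -enorm2 b2.
rewrite -/m mE in chord.
have tv : (t * enorm (v t)) ^+ 2 <= 2 * (C1 * halfdist c t).
  rewrite exprMn enorm_v2; move: q_le tgap; rewrite /energy.
  lra.
have trad : t * radial c t <= t * enorm (v t) * enorm (x t - c).
  by rewrite -mulrA ler_pM2l//; exact: dot_le_enorm.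
have ly : lyap c t <= C1 * halfdist c t + lam * (t * radial c t)
    + lam * (alpha - 1) * halfdist c t.
  by rewrite /lyap !lerD2r.
have m_le : enorm m <= t * enorm (v t) + (alpha - 1) * enorm (x t - c).
  apply: le_trans (ler_enormD _ _) _; rewrite !enormZ (gtr0_norm t_gt0).
  by rewrite ger0_norm//; lra.
exact: (drift_bound l0 la (ltW C10) k0 b0 (enorm_ge0 m) tv b2 trad ly m_le err
  zm NE chord).
Qed.

(** The function t `^ (2 * lam) * halfdist c t decreases wherever it is at least
    A, hence it is bounded, and it controls the energy through rlyap c. *)
Lemma energy_rate c (eta T K r : R) : argmin F c -> flat_ball gamma c eta ->
  t0 < T -> (forall u, T <= u -> enorm (x u - c) < eta) ->
  (forall eps : R, 0 < eps ->
     exists2 T : R, t0 < T & forall t, T <= t -> lyap c t <= eps) ->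
  0 < K -> 0 < r ->
  (forall y, enorm (y - c) < r ->
     K * edistance y (argmin F) `^ gamma <= F y - inf_val F) ->
  exists M T', [/\ 0 <= M, T <= T' & forall t, T' <= t ->
    t `^ (2 * lam) * (t ^+ 2 * energy t) <= M].
Proof.
move=> minc Hc tT near_c lyap0 K0 r0 growth.
have la := lam_alpha; have l0 := lam_gt0; have tp := t0_gt0.
pose C := Num.max 0 (T `^ (2 * lam) * rlyap c T).
have C0 : 0 <= C by rewrite le_max lexx.
have rC t : T <= t -> t `^ (2 * lam) * rlyap c t <= C.
  move=> Tt; rewrite le_max; apply/orP; right.
  exact: (weighted_rlyap_nonincreasing minc Hc tT near_c (lexx T) Tt).
have [A [T' [A0 TT' decay]]] :=
  radial_decay minc Hc tT near_c lyap0 C0 rC K0 r0 growth.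
have tT' : t0 < T' by exact: lt_le_trans TT'.
pose Z u := u `^ (2 * lam) * halfdist c u.
pose dZ u := 2 * lam / u * u `^ (2 * lam) * halfdist c u
  + u `^ (2 * lam) * radial c u.
have ZD u : t0 < u -> is_derive u 1 Z (dZ u).
  move=> tu; apply: is_deriveMf; last exact: is_derive_halfdist.
  by apply: is_derive_powR; exact: lt_trans tu.
have Z_le : forall t, T' <= t -> Z t <= Num.max A (Z T').
  apply: (barrier ZD tT') => u T'u AZ.
  have u0 : 0 < u by rewrite (lt_trans t0_gt0)// (lt_le_trans tT').
  have P0 : 0 < u `^ (2 * lam) by exact: powR_gt0.
  have k0 : 0 < halfdist c u.
    by rewrite -(pmulr_rgt0 _ P0); exact: lt_le_trans A0 AZ.
  have [_ dec] := decay u T'u AZ.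
  have -> : dZ u = u `^ (2 * lam) / u * (2 * lam * halfdist c u + u * radial c u).
    by rewrite /dZ; field; rewrite gt_eqF.
  rewrite pmulr_rlt0 ?divr_gt0//.
  have := mulr_gt0 l0 k0; lra.
pose C1 := 4 * lam ^+ 2 + 2 * lam * (alpha - 1 - 2 * lam).
have C10 : 0 <= C1.
  have h1 := sqr_ge0 lam.
  have h2 : 0 <= 2 * lam * (alpha - 1 - 2 * lam) by apply: mulr_ge0; lra.
  by rewrite /C1; lra.
exists (C1 * Num.max A (Z T') + 2 * C), T'; split => //.
  by rewrite addr_ge0 ?mulr_ge0// le_max ltW.
move=> t T't.
have t_gt0 : 0 < t by rewrite (lt_trans t0_gt0)// (lt_le_trans tT').
have P0 : 0 < t `^ (2 * lam) by exact: powR_gt0.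
have D : rlyap c t <= C / t `^ (2 * lam).
  by rewrite ler_pdivlMr// mulrC rC// (le_trans TT').
have := energy_le_halfdist minc t_gt0 D; rewrite -/C1 => h.
apply: (le_trans (ler_wpM2l (ltW P0) h)).
rewrite mulrDr; apply: lerD.
  by rewrite mulrCA ler_wpM2l// Z_le.
by rewrite mulrCA (mulrCA _ C) divff ?mulr1// gt_eqF.
Qed.

End Capture.
End Trajectory.

(** * Integrability of the speed *)

Section PowerTail.
Context {R : realType}.

Lemma powRN_cvg0 (a : R) : 0 < a -> t `^ (- a) @[t --> +oo] --> (0 : R).
Proof.
move=> a0; apply/cvgrPdist_lt => eps eps0; near=> t.
have t0 : 0 < t by near: t; exact: nbhs_pinfty_gt.
rewrite sub0r normrN ger0_norm ?powR_ge0// powRN invf_plt ?posrE ?powR_gt0//.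
have -> : eps^-1 = (eps^-1 `^ a^-1) `^ a.
  by rewrite -powRrM mulVf ?gt_eqF// powRr1// invr_ge0 ltW.
rewrite gt0_ltr_powR ?nnegrE ?powR_ge0// ?(ltW t0)//.
Unshelve. all: by end_near. Qed.

Lemma integral_power_tail (M a t0 : R) : 0 <= M -> 0 < a -> 0 < t0 ->
  (\int[lebesgue_measure]_(t in `[t0, +oo[) (M * t `^ (- (a + 1)))%:E < +oo)%E.
Proof.
move=> M0 a0 t00.
pose G t : R := - (M / a) * t `^ (- a).
have GD (t : R) : 0 < t -> is_derive t 1 G (M * t `^ (- (a + 1))).
  move=> tp; have D := is_deriveZf (- (M / a)) (is_derive_powR (- a) tp).
  apply: (is_derive_eq D).
  have -> : t `^ (- (a + 1)) = t `^ (- a) / t.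
    rewrite opprD powRD; last by rewrite (gt_eqF tp) implybT.
    by rewrite powR_inv1 ?ltW.
  by field; rewrite !gt_eqF.
have fc (t : R) : 0 < t -> {for t, continuous (fun s => M * s `^ (- (a + 1)))}.
  move=> tp; apply: is_derive_continuous.
  exact: is_deriveZf (is_derive_powR _ tp).
pose f t : R := M * t `^ (- (a + 1)).
have f_ge0 t : t0 <= t -> 0 <= f t by move=> _; rewrite mulr_ge0 ?powR_ge0.
have f_cont : {within `[t0, +oo[, continuous f}.
  apply/continuous_within_itvcyP; split.
    by move=> t; rewrite in_itv/= andbT => t0t; apply/fc/(lt_trans t00).
  by apply: cvg_at_right_filter; exact: fc.
have G_cvg : G x @[x --> +oo] --> (0 : R).
  by rewrite -(mulr0 (- (M / a))); apply: cvgMr; exact: powRN_cvg0.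
have G_derivable t : t0 < t -> derivable G t 1.
  by move=> t0t; case: (GD t (lt_trans t00 t0t)).
have G_right : G x @[x --> t0^'+] --> G t0.
  by apply: cvg_at_right_filter; exact: is_derive_continuous (GD _ t00).
have Gf : {in `]t0, +oo[, derive1 G =1 f}.
  move=> t; rewrite in_itv/= andbT => t0t; rewrite derive1E.
  by case: (GD t (lt_trans t00 t0t)).
have FTC := ge0_continuous_FTC2y f_ge0 f_cont G_cvg G_derivable G_right Gf.
by rewrite -/f FTC -EFinB ltry.
Qed.

End PowerTail.

(** The energy bounds the speed from any time after t0 on; near t0 the bound
    comes from the one-sided derivative. *)
Lemma velocity_bounded_near (R : realType) (n : nat) (t0 : R)
    (v : R -> 'rV[R]_n) (d : 'rV[R]_n) :
  h^-1 *: (v (t0 + h) - v t0) @[h --> 0^'+] --> d ->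
  exists B delta, [/\ 0 <= B, 0 < delta &
    forall t, t0 <= t -> t < t0 + delta -> enorm (v t) <= B].
Proof.
move=> /cvgrPdist_lt/(_ 1 ltr01)[delta /= delta0 Hd].
pose dd := Num.min delta 1.
exists (enorm (v t0) + n%:R * (`|d| + 1)), dd; split.
- by rewrite addr_ge0 ?enorm_ge0// mulr_ge0// addr_ge0.
- by rewrite lt_min delta0 ltr01.
move=> t; rewrite le_eqVlt => /predU1P[<- _|t0t].
  by rewrite lerDl mulr_ge0// addr_ge0.
rewrite -ltrBlDl lt_min => /andP[td t1].
have h0 : 0 < t - t0 by rewrite subr_gt0.
have := Hd (t - t0); rewrite /ball_/= sub0r normrN gtr0_norm// => /(_ td h0).
rewrite subrKC => dv.
have vv : `|v t - v t0| <= `|d| + 1.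
  set w := _ *: _ in dv.
  have -> : v t - v t0 = (t - t0) *: w by rewrite scalerA divff ?scale1r// gt_eqF.
  rewrite normrZ gtr0_norm//; apply: (@le_trans _ _ `|w|).
    by rewrite ler_piMl// ltW.
  rewrite -[w](subKr d); apply: le_trans (ler_normB _ _) _.
  by rewrite lerD2l ltW.
rewrite -[v t](subrK (v t0)) addrC.
apply: le_trans (ler_enormD _ _) _; rewrite lerD2l.
by apply: le_trans (enorm_le_normr _) _; rewrite ler_wpM2l.
Qed.

Lemma integral_enorm_lty (R : realType) (n : nat) (t0 M a : R)
    (v : R -> 'rV[R]_n) :
  0 < t0 -> 0 <= M -> 0 < a ->
  (forall t, t0 < t -> {for t, continuous v}) ->
  (forall t, t0 <= t -> enorm (v t) <= M * t `^ (- (a + 1))) ->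
  (\int[lebesgue_measure]_(t in `[t0, +oo[) (enorm (v t))%:E < +oo)%E.
Proof.
move=> t00 M0 a0 vc vM.
have mv : measurable_fun `]t0, +oo[ (fun t => enorm (v t)).
  apply: open_continuous_measurable_fun; first exact: interval_open.
  move=> t; rewrite inE/= in_itv/= andbT => t0t.
  apply/cvgrPdist_lt => e e0.
  have n1 : 0 < n%:R + 1 :> R by rewrite ltr_wpDl.
  have [d /= d0 Hd] := (cvgrPdist_lt _ _).1 (vc t t0t) _ (divr_gt0 e0 n1).
  exists d => // s ts; have := Hd s ts.
  have h : `|enorm (v t) - enorm (v s)| <= enorm (v t - v s).
    rewrite ler_norml; apply/andP; split.
      have := ler_enormD (v s - v t) (v t); rewrite subrK enorm_distC; lra.
    by have := ler_enormD (v t - v s) (v s); rewrite subrK; lra.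
  rewrite ltr_pdivlMr// => Hs; apply: le_lt_trans h _.
  apply: le_lt_trans (enorm_le_normr _) _; apply: le_lt_trans Hs.
  by rewrite mulrC ler_wpM2l// lerDl.
rewrite -integral_itv_obnd_cbnd; last exact/measurable_EFinP.
apply: le_lt_trans (integral_power_tail M0 a0 t00).
rewrite -[leRHS]integral_itv_obnd_cbnd; last first.
  apply/measurable_EFinP; apply: measurable_funM => //.
  by apply: measurable_funTS; exact: measurable_powR.
apply: ge0_le_integral => //.
- by move=> t _; rewrite lee_fin enorm_ge0.
- exact/measurable_EFinP.
- apply/measurable_EFinP; apply: measurable_funM => //.
  by apply: measurable_funTS; exact: measurable_powR.
- by move=> t /=; rewrite in_itv/= andbT => t0t; rewrite lee_fin vM// ltW.
Qed.

Theorem corollary4p6 (R : realType) (n : nat) (F : 'rV[R]_n -> R)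
    (gamma alpha t0 : R) (x v : R -> 'rV[R]_n) :
  convex_function [set: 'rV[R]_n] F ->
  (forall y, differentiable F y) ->
  argmin F !=set0 ->
  2 < gamma -> 0 < alpha -> 0 < t0 ->
  well_posed F alpha t0 ->
  is_solution F alpha t0 x v ->
  coercive F ->
  H1 F gamma -> H2 F gamma ->
  (gamma + 2) / (gamma - 2) <= alpha ->
  [/\ (fun t => F (x t) - inf_val F) =O_+oo
        (fun t => (t `^ (2 * gamma / (gamma - 2)))^-1),
      (fun t => enorm (v t)) =O_+oo (fun t => (t `^ (gamma / (gamma - 2)))^-1),
      (\int[lebesgue_measure]_(t in `[t0, +oo[) (enorm (v t))%:E < +oo)%E &
      exists2 xs, argmin F xs & x t @[t --> +oo] --> xs].
Proof.
move=> Fconvex Fdiff [c0 minc0] gamma2 alpha0 t00 _ [[xD _] [a [aD aR] ode]].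
move=> Fcoercive hH1 hH2 gamma_alpha.
have g2 : 0 < gamma - 2 by rewrite subr_gt0.
pose lam := 2 / (gamma - 2).
have lam0 : 0 < lam by rewrite divr_gt0.
have lam_gamma : gamma * lam = 2 * lam + 2.
  by rewrite /lam; field; rewrite gt_eqF.
have lam_alpha : 2 * lam <= alpha - 1.
  rewrite lerBrDr; apply: le_trans gamma_alpha.
  by rewrite le_eqVlt; apply/orP; left; apply/eqP; rewrite /lam; field; rewrite gt_eqF.
have vD t : t0 < t -> is_derive t 1 v (- (alpha / t) *: v t - grad F (x t)).
  move=> t0t; have D := aD t t0t; apply: (is_derive_eq D).
  have := ode t (ltW t0t); rewrite scaleNr -addrA => /eqP.
  by rewrite addr_eq0 opprD => /eqP.
(* the energy is known to decrease only after t0: start at a later time *)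
pose t1 := t0 + 1.
have t01 : t0 < t1 by rewrite ltrDl.
have t10 : 0 < t1 by exact: lt_trans t01.
have xD1 t : t1 < t -> is_derive t 1 x (v t) by move=> h; apply/xD/(lt_trans t01).
have vD1 t : t1 < t -> is_derive t 1 v (- (alpha / t) *: v t - grad F (x t)).
  by move=> h; apply/vD/(lt_trans t01).
have flat c : argmin F c -> exists2 eta : R, 0 < eta & flat_ball F gamma c eta.
  move=> minc; have [eta eta0 h] := hH1 c minc; exists eta => // y yc.
  by rewrite mulrC -ler_pdivlMr ?(lt_trans _ gamma2)// mulrC; exact: h.
have energy_le := energy_nonincreasing Fdiff t00 xD vD (ltW alpha0).
have [B xB] : exists B, forall t, t1 < t -> enorm (x t) <= B.
  have [B HB] := Fcoercive (inf_val F + energy F x v t1 + 1).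
  exists B => t tt; rewrite leNgt; apply/negP => /ltW /HB.
  have := energy_le _ _ t01 (ltW tt); have := kinetic_ge0 v t.
  by rewrite [energy F x v t]/energy /gap; lra.
have [c minc lyap0] :=
  capture Fconvex Fdiff t10 xD1 vD1 lam0 lam_gamma lam_alpha flat minc0 xB.
have [eta eta0 Hc] := flat c minc.
have [K [r [K0 r0 growth]]] := hH2 c minc.
pose t2 := t1 + 1.
have t12 : t1 < t2 by rewrite ltrDl.
have small := vanishing t10 lam0 lam_alpha minc t12 lyap0.
have eta2 : 0 < eta / 2 by rewrite divr_gt0.
have [T t2T HT] := small _ eta2.
have t1T : t1 < T by exact: lt_le_trans t2T.
have near_c u : T <= u -> enorm (x u - c) < eta.
  by move=> /HT[_ h]; apply: le_lt_trans h _; lra.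
have [M [T' [M0 TT' rate]]] := energy_rate Fconvex Fdiff t10 xD1 vD1 lam0
  lam_gamma lam_alpha minc Hc t1T near_c lyap0 K0 r0 growth.
have T'0 : 0 < T' by exact: lt_le_trans (lt_trans t10 t1T) TT'.
have gap_rate t : T' <= t ->
    F (x t) - inf_val F <= M * (t `^ (2 * gamma / (gamma - 2)))^-1.
  move=> T't; have tp : 0 < t by exact: lt_le_trans T't.
  rewrite ler_pdivlMr ?powR_gt0//; apply: le_trans (rate t T't).
  have -> : 2 * gamma / (gamma - 2) = 2 * lam + 2.
    by rewrite /lam; field; rewrite gt_eqF.
  rewrite powRD ?(gt_eqF tp) ?implybT// powR_mulrn ?(ltW tp)//.
  rewrite mulrC -mulrA ler_wpM2l ?powR_ge0// ler_wpM2l ?sqr_ge0//.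
  by rewrite /energy lerDl kinetic_ge0.
have lam1 : gamma / (gamma - 2) = lam + 1 by rewrite /lam; field; rewrite gt_eqF.
have v_rate t : T' <= t -> enorm (v t) <= Num.sqrt (2 * M) * t `^ (- (lam + 1)).
  move=> T't; have tp : 0 < t by exact: lt_le_trans T't.
  rewrite powRN ler_pdivlMr ?powR_gt0//.
  apply: le_of_sqr; first exact: sqrtr_ge0.
  rewrite sqr_sqrtr ?mulr_ge0// exprMn enorm_v2.
  rewrite -[_ `^ _ ^+ 2]powR_mulrn ?powR_ge0// -powRrM.
  have -> : (lam + 1) * 2 = 2 * lam + 2 by ring.
  rewrite powRD ?(gt_eqF tp) ?implybT// powR_mulrn ?(ltW tp)//.
  rewrite -mulrA ler_pM2l//; apply: le_trans (rate t T't).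
  rewrite mulrC -mulrA ler_wpM2l ?powR_ge0// ler_wpM2l ?sqr_ge0//.
  by rewrite /energy lerDr (gap_ge0 _ _ minc).
split.
- apply/eqO_exP; exists (M + 1); first by rewrite ltr_wpDl.
  near=> t; have T't : T' <= t by near: t; apply: nbhs_pinfty_ge; exact: num_real.
  rewrite !ger0_norm ?invr_ge0 ?powR_ge0//; last first.
    exact: gap_ge0 _ _ minc.
  apply: le_trans (gap_rate t T't) _.
  by rewrite ler_wpM2r ?invr_ge0 ?powR_ge0// lerDl.
- apply/eqO_exP; exists (Num.sqrt (2 * M) + 1); first by rewrite ltr_wpDl// sqrtr_ge0.
  near=> t; have T't : T' <= t by near: t; apply: nbhs_pinfty_ge; exact: num_real.
  rewrite !ger0_norm ?invr_ge0 ?powR_ge0 ?enorm_ge0//.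
  apply: le_trans (v_rate t T't) _; rewrite lam1 powRN.
  by rewrite ler_wpM2r ?invr_ge0 ?powR_ge0// lerDl.
- have [B1 [d [B10 d0 vB1]]] := velocity_bounded_near aR.
  pose s := t0 + d / 2.
  have t0s : t0 < s by rewrite ltrDl divr_gt0.
  pose e1 := energy F x v s.
  have e10 : 0 <= e1 by exact: energy_ge0 minc.
  pose B2 := B1 + (e1 + 1).
  have vB2 t : t0 <= t -> enorm (v t) <= B2.
    move=> t0t; have [ts|st] := ltP t (t0 + d).
      by apply: le_trans (vB1 t t0t ts) _; rewrite lerDl addr_ge0.
    have st' : s <= t by apply: le_trans st; rewrite lerD2l; lra.
    have h : enorm (v t) <= e1 + 1.
      have := energy_le _ _ t0s st'; have := gap_ge0 x t minc; have := enorm_v2 v t.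
      by rewrite -/e1 [energy F x v t]/energy; have := enorm_ge0 (v t); nra.
    by apply: le_trans h _; rewrite lerDr.
  have B20 : 0 <= B2 by exact: addr_ge0 B10 (addr_ge0 e10 ler01).
  (* before T' the bound on the speed is turned into a multiple of the power *)
  pose M1 := Num.max (Num.sqrt (2 * M)) (B2 * T' `^ (lam + 1)).
  apply: (@integral_enorm_lty _ _ t0 M1 lam) => //.
  + by rewrite le_max sqrtr_ge0.
  + move=> t t0t; have [Dv _] := vD t t0t.
    exact/differentiable_continuous/derivable1_diffP.
  + move=> t t0t; have tp : 0 < t by exact: lt_le_trans t0t.
    have [tT'|T't] := ltP t T'; last first.
      apply: le_trans (v_rate t T't) _.
      by rewrite ler_wpM2r ?powR_ge0// le_max lexx.
    apply: le_trans (vB2 t t0t) _; rewrite powRN ler_pdivlMr ?powR_gt0//.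
    rewrite le_max; apply/orP; right; rewrite ler_wpM2l//.
    by apply: le_powR; rewrite ?(ltW tp) ?(ltW tT')//; lra.
- exists c => //; apply/cvgrPdist_lt => e e0.
  have e2 : 0 < e / 2 by rewrite divr_gt0.
  have [T1 _ HT1] := small _ e2.
  near=> t; have T1t : T1 <= t by near: t; apply: nbhs_pinfty_ge; exact: num_real.
  have [_ h] := HT1 t T1t; rewrite distrC.
  by apply: le_lt_trans (normr_le_enorm _) _; lra.
Unshelve. all: by end_near. Qed.
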